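(* Let $\mathcal{A}=\{A_0,A_1,A_2\}$ be the standard basis of a symmetric rank $3$ standard integral table algebra (for instance the adjacency matrices of the association scheme of a strongly regular graph), with character table $$\begin{bmatrix}1&k&\ell\\ 1&r&-1-r\\ 1&s&-1-s\end{bmatrix},\qquad r\ge s .$$ Suppose that none of the following parameter conditions holds: (a) $k=r$ and $s=-1$; (b) $\ell=-1-s$ and $r=0$; (c) $k=\ell$ and $s=-1-r$; (d) $k=s^2$, $\ell=-2s$ and $r=1$; (e) $k=2(1+r)$, $\ell=(1+r)^2$ and $s=-2$; (f) $k=3-s-r$ and $\ell=5+s+r$; (g) $k=r(3+r)$, $\ell=3+r$ and $s=-2$; (h) $\ell=-k(s+1)$, $k=2-s$ and $r=1$; (i) $k=r(2r+1)$, $\ell=(r-1)(2r+1)$ and $s=-r$; (j) $k=(s+2)(2s+1)$, $\ell=(s+1)(2s+1)$ and $r=-2-s$. Then the only partitions of $\{2,\dots,9\}$ that give a fusion of $\mathcal{A}\otimes\mathcal{A}$ are the following fifteen: $2|3|4|5|6|7|8|9$, $23456789$, $2|3|47|58|69$, $24|37|5|68|9$, $23|4|56|7|89$, $2|3|456|789$, $4|7|258|369$, $23|456|789$, $47|258|369$, $2|3|456789$, $23|47|5689$, $4|7|235689$, $2347|5689$, $23|456789$, $47|235689$. These are exactly the partitions giving a fusion for every such $\mathcal{A}$.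
   Context: A symmetric rank $3$ standard integral table algebra is a commutative associative complex algebra with basis $A_0=1,A_1,A_2$ such that the structure constants $\lambda_{ijh}$ (defined by $A_iA_j=\sum_h\lambda_{ijh}A_h$) are nonnegative reals, $\lambda_{ij0}=0$ for $i\neq j$, and $\lambda_{ii0}=\delta(A_i)$ is a positive integer, where $\delta$ is the algebra homomorphism to $\mathbb{C}$ (valency map) with $\delta(A_i)=\lambda_{ii0}$. The main example: $A_0=I_n$, $A_1$ the adjacency matrix of a strongly regular graph on $n$ vertices that is neither complete nor edgeless, $A_2=J-I-A_1$ the adjacency matrix of its complement. Set $k=\delta(A_1)$, $\ell=\delta(A_2)$. The algebra has three characters $\chi_0=\delta,\chi_1,\chi_2$; the character table has rows $\chi_0,\chi_1,\chi_2$ and columns $A_0,A_1,A_2$, of the displayed form. The tensor square $\mathcal{A}\otimes\mathcal{A}$ is the algebra with basis $A_{ij}=A_i\otimes A_j$ ($i,j\in\{0,1,2\}$), relabelled $C_{3j+i+1}=A_{ij}$: $C_1=A_{00},C_2=A_{10},C_3=A_{20},C_4=A_{01},C_5=A_{11},C_6=A_{21},C_7=A_{02},C_8=A_{12},C_9=A_{22}$. A partition of $\{2,\dots,9\}$ is written by listing its blocks separated by bars (e.g. $24|37|5|68|9$ has blocks $\{2,4\},\{3,7\},\{5\},\{6,8\},\{9\}$). A partition $\tau$ gives a fusion of $\mathcal{A}\otimes\mathcal{A}$ if the linear span of $C_1$ and the sums $C_T=\sum_{t\in T}C_t$ over the blocks $T$ of $\tau$ is closed under multiplication (so these elements form a basis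 of a subalgebra).
   Formalization: Conditions (a)–(j) are assumed to fail also with r and s exchanged, which for r ≥ s adds only the mirrors of (i) and (j); as stated it fails, e.g. k=15, l=20, r=3, s=-3 (SRG(36,15,6,6)) satisfies none of (a)–(j) but 2468|3579 gives a fusion. *)

(* Defs.v *)
From HB Require Import structures.
From mathcomp Require Import all_boot all_order all_algebra all_field.
From mathcomp Require Import complex reals.

Set Implicit Arguments.
Unset Strict Implicit.
Unset Printing Implicit Defensive.

Import Order.TTheory GRing.Theory Num.Theory.
Local Open Scope ring_scope.
Local Open Scope complex_scope.

(* The complex numbers, as the structure on R[i] rather than the bare type. *)
Definition Cx (R : realType) : numClosedFieldType := R[i].

Definition structure_constant (F : fieldType) (V : falgType F)
    (b : 3.-tuple V) (i j h : 'I_3) : F :=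
  coord b h (tnth b i * tnth b j).

(* The order on [Cx R] is partial: [0 <= z] says that z is real and
   nonnegative.  Algebra homomorphisms to the complex numbers are the elements
   of ['AHom(V, (Cx R)^o)], where (Cx R)^o is [Cx R] as an algebra over itself.
   An [falgType] is an arbitrary finite-dimensional unital algebra. *)
Record sita3 (R : realType) := Sita3 {
  alg :> falgType (Cx R);
  std : 3.-tuple alg;
  valency : 'AHom(alg, (Cx R)^o);
  std_basis : basis_of {:alg} std;
  std0 : tnth std ord0 = 1;
  alg_mulC : forall x y : alg, x * y = y * x;
  structure_constant_ge0 : forall i j h, 0 <= structure_constant std i j h;
  structure_constant_neq :
    forall i j, i != j -> structure_constant std i j ord0 = 0;
  structure_constant_eq :
    forall i, structure_constant std i i ord0 = valency (tnth std i);
  valency_nat : forall i, exists2 d : nat,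
    (0 < d)%N & valency (tnth std i) = d%:R
}.

Definition table3 (R : realType) (k l r s : R) : 'M[R]_3 :=
  \matrix_(i < 3, j < 3)
    (nth [::] [:: [:: 1; k; l];
                  [:: 1; r; -1 - r];
                  [:: 1; s; -1 - s]] i)`_j.

Definition has_character_table (R : realType) (A : sita3 R) (k l r s : R) :=
  exists chi : 'I_3 -> 'AHom(A, (Cx R)^o),
    [/\ chi ord0 = valency A,
        injective chi,
        forall phi, exists i, phi = chi i
      & (\matrix_(i < 3, j < 3) (chi i (tnth (std A) j) : Cx R)) =
        map_mx (real_complex R) (table3 k l r s)].

(* The tensor square of A in coordinates: [mxvec M] stands for the sum of the
   M i j *: (A_i (x) A_j).  Row vectors are used rather than square matrices
   because the latter already carry the matrix product.  The product [tmul] is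
   characterized by bilinearity and lemma [tensM]. *)
Definition tensor2 (R : realType) (A : sita3 R) : Type := 'rV[Cx R]_(3 * 3).

Section TensorSquare.
Variables (R : realType) (A : sita3 R).
Local Notation b i := (tnth (std A) i).
Local Notation tensor2 := (tensor2 A).

HB.instance Definition _ := Vector.copy tensor2 'rV[Cx R]_(3 * 3).

Definition tens (x y : A) : tensor2 :=
  mxvec (\matrix_(i < 3, j < 3) (coord (std A) i x * coord (std A) j y)).

Definition tcoord (X : tensor2) (p : 'I_3 * 'I_3) : Cx R := vec_mx X p.1 p.2.

Definition tmul (X Y : tensor2) : tensor2 :=
  \sum_(p : 'I_3 * 'I_3) \sum_(q : 'I_3 * 'I_3)
    (tcoord X p * tcoord Y q) *: tens (b p.1 * b q.1) (b p.2 * b q.2).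

Lemma tens_linear_l y : linear (fun x => tens x y).
Proof.
move=> a u v; rewrite /tens -linearP; congr mxvec; apply/matrixP=> i j.
by rewrite !mxE linearP mulrDl mulrA.
Qed.

Lemma tens_linear_r x : linear (tens x).
Proof.
move=> a u v; rewrite /tens -linearP; congr mxvec; apply/matrixP=> i j.
by rewrite !mxE linearP mulrDr mulrCA.
Qed.

Lemma tcoordP a X Y p : tcoord (a *: X + Y) p = a * tcoord X p + tcoord Y p.
Proof. by rewrite /tcoord linearP !mxE. Qed.

Lemma tmul_linear_l Y : linear (fun X => tmul X Y).
Proof.
move=> a U V; rewrite /tmul scaler_sumr -big_split; apply: eq_bigr => p _ /=.
rewrite scaler_sumr -big_split; apply: eq_bigr => q _ /=.
by rewrite tcoordP mulrDl -mulrA scalerDl scalerA.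
Qed.

Lemma tmul_linear_r X : linear (tmul X).
Proof.
move=> a U V; rewrite /tmul scaler_sumr -big_split; apply: eq_bigr => p _ /=.
rewrite scaler_sumr -big_split; apply: eq_bigr => q _ /=.
by rewrite tcoordP mulrDr mulrCA scalerDl scalerA.
Qed.

Lemma tens_std i j : tens (b i) (b j) = mxvec (delta_mx i j).
Proof.
have fb := basis_free (std_basis A); congr mxvec.
apply/matrixP=> u v; rewrite !mxE !(tnth_nth 0) !coord_free //.
by rewrite -natrM mulnb ![_ == u]eq_sym ![_ == v]eq_sym.
Qed.

Lemma tcoord_std i j p : tcoord (tens (b i) (b j)) p = (p == (i, j))%:R.
Proof. by rewrite tens_std /tcoord mxvecK mxE -xpair_eqE -surjective_pairing. Qed.

Lemma std_ind (P : A -> Prop) :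
  P 0 -> (forall a x y, P x -> P y -> P (a *: x + y)) -> (forall i, P (b i)) ->
  forall x, P x.
Proof.
move=> P0 Plin Pb x.
rewrite (coord_basis (std_basis A) (memvf x)).
elim/big_rec: _ => [|i y _ Py]; first exact: P0.
by apply: Plin => //; rewrite -tnth_nth.
Qed.

Lemma tens_ind (P : tensor2 -> Prop) :
  P 0 -> (forall a X Y, P X -> P Y -> P (a *: X + Y)) ->
  (forall x y, P (tens x y)) -> forall X, P X.
Proof.
move=> P0 Plin Pt X; rewrite -[X]vec_mxK [vec_mx X]matrix_sum_delta.
rewrite pair_big linear_sum.
elim/big_rec: _ => [|p Y _ PY]; first exact: P0.
by rewrite linearZ; apply: Plin => //=; rewrite -tens_std.
Qed.

Lemma lin0 (U V : lmodType (Cx R)) (f : U -> V) : linear f -> f 0 = 0.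
Proof. by move=> /(_ (-1) 0 0); rewrite scaler0 add0r scaleN1r addNr. Qed.

Lemma tens0l y : tens 0 y = 0. Proof. exact: lin0 (tens_linear_l y). Qed.
Lemma tens0r x : tens x 0 = 0. Proof. exact: lin0 (tens_linear_r x). Qed.
Lemma tensPl a x x' y : tens (a *: x + x') y = a *: tens x y + tens x' y.
Proof. exact: tens_linear_l. Qed.
Lemma tensPr a x y y' : tens x (a *: y + y') = a *: tens x y + tens x y'.
Proof. exact: tens_linear_r. Qed.
Lemma tmul0l Y : tmul 0 Y = 0. Proof. exact: lin0 (tmul_linear_l Y). Qed.
Lemma tmul0r X : tmul X 0 = 0. Proof. exact: lin0 (tmul_linear_r X). Qed.
Lemma tmulPl a X X' Y : tmul (a *: X + X') Y = a *: tmul X Y + tmul X' Y.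
Proof. exact: tmul_linear_l. Qed.
Lemma tmulPr a X Y Y' : tmul X (a *: Y + Y') = a *: tmul X Y + tmul X Y'.
Proof. exact: tmul_linear_r. Qed.

Lemma tensM x y x' y' :
  tmul (tens x y) (tens x' y') = tens (x * x') (y * y').
Proof.
elim/std_ind: x => [|a u v Hu Hv|i].
- by rewrite mul0r !tens0l tmul0l.
- by rewrite tensPl tmulPl Hu Hv mulrDl -scalerAl tensPl.
elim/std_ind: y => [|a u v Hu Hv|j].
- by rewrite mul0r !tens0r tmul0l.
- by rewrite tensPr tmulPl Hu Hv mulrDl -scalerAl tensPr.
elim/std_ind: x' => [|a u v Hu Hv|i'].
- by rewrite mulr0 !tens0l tmul0r.
- by rewrite tensPl tmulPr Hu Hv mulrDr -scalerAr tensPl.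
elim/std_ind: y' => [|a u v Hu Hv|j'].
- by rewrite mulr0 !tens0r tmul0r.
- by rewrite tensPr tmulPr Hu Hv mulrDr -scalerAr tensPr.
rewrite /tmul (bigD1 (i, j)) //= (bigD1 (i', j')) //= !tcoord_std !eqxx.
rewrite mulr1 scale1r !big1 ?addr0 // => p /negPf ne.
  by rewrite big1 // => q _; rewrite tcoord_std ne mul0r scale0r.
by rewrite tcoord_std ne mulr0 scale0r.
Qed.

Lemma tmulA : associative tmul.
Proof.
move=> X Y Z.
elim/tens_ind: X => [|a U V HU HV|x y]; first by rewrite !tmul0l.
  by rewrite !tmulPl HU HV.
elim/tens_ind: Y => [|a U V HU HV|x' y']; first by rewrite tmul0r !tmul0l tmul0r.
  by rewrite !(tmulPl, tmulPr) HU HV.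
elim/tens_ind: Z => [|a U V HU HV|x'' y'']; first by rewrite !tmul0r.
  by rewrite !tmulPr HU HV.
by rewrite !tensM !mulrA.
Qed.

Lemma tmul1l : left_id (tens 1 1) tmul.
Proof.
move=> X; elim/tens_ind: X => [|a U V HU HV|x y]; first by rewrite tmul0r.
  by rewrite tmulPr HU HV.
by rewrite tensM !mul1r.
Qed.

Lemma tmul1r : right_id (tens 1 1) tmul.
Proof.
move=> X; elim/tens_ind: X => [|a U V HU HV|x y]; first by rewrite tmul0l.
  by rewrite tmulPl HU HV.
by rewrite tensM !mulr1.
Qed.

Lemma tmulDl : left_distributive tmul +%R.
Proof. by move=> X Y Z; rewrite -[X]scale1r tmulPl !scale1r. Qed.

Lemma tmulDr : right_distributive tmul +%R.
Proof. by move=> X Y Z; rewrite -[Y]scale1r tmulPr !scale1r. Qed.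

Lemma tens11_neq0 : tens 1 1 != 0.
Proof.
apply/eqP => /(congr1 (fun X => tcoord X (ord0, ord0))) /eqP.
by rewrite -(std0 A) tcoord_std eqxx /tcoord linear0 mxE oner_eq0.
Qed.

HB.instance Definition _ := GRing.Zmodule_isNzRing.Build tensor2
  tmulA tmul1l tmul1r tmulDl tmulDr tens11_neq0.

Lemma tmulE (X Y : tensor2) : X * Y = tmul X Y. Proof. by []. Qed.

Lemma tmul_scaleAl (a : Cx R) (X Y : tensor2) : a *: (X * Y) = (a *: X) * Y.
Proof. by rewrite !tmulE -[a *: X in RHS]addr0 tmulPl tmul0l addr0. Qed.
HB.instance Definition _ := GRing.Lmodule_isLalgebra.Build (Cx R) tensor2
  tmul_scaleAl.

Lemma tmul_scaleAr (a : Cx R) (X Y : tensor2) : a *: (X * Y) = X * (a *: Y).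
Proof. by rewrite !tmulE -[a *: Y in RHS]addr0 tmulPr tmul0r addr0. Qed.
HB.instance Definition _ := GRing.Lalgebra_isAlgebra.Build (Cx R) tensor2
  tmul_scaleAr.
HB.instance Definition _ := Algebra_isFalgebra.Build (Cx R) tensor2.

(* C_(3j+i+1) = A_i (x) A_j; meaningful for 1 <= t <= 9. *)
Definition C_ (t : 'I_10) : tensor2 :=
  tens (b (inord (t.-1 %% 3))) (b (inord (t.-1 %/ 3))).

Definition C_sum (T : {set 'I_10}) : tensor2 := \sum_(t in T) C_ t.

Definition fusion_span (tau : {set {set 'I_10}}) : {vspace tensor2} :=
  <<C_ (inord 1) :: [seq C_sum T | T <- enum tau]>>%VS.

Definition gives_fusion (tau : {set {set 'I_10}}) : Prop :=
  (fusion_span tau * fusion_span tau <= fusion_span tau)%VS.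

End TensorSquare.

Definition labels : {set 'I_10} := [set t : 'I_10 | (2 <= t)%N].

Definition of_blocks (bs : seq (seq nat)) : {set {set 'I_10}} :=
  [set:: [seq [set:: [seq (inord t : 'I_10) | t <- T]] | T <- bs]].

Definition fifteen : seq {set {set 'I_10}} := [seq of_blocks bs | bs <- [::
  [:: [:: 2]; [:: 3]; [:: 4]; [:: 5]; [:: 6]; [:: 7]; [:: 8]; [:: 9]];
  [:: [:: 2; 3; 4; 5; 6; 7; 8; 9]];
  [:: [:: 2]; [:: 3]; [:: 4; 7]; [:: 5; 8]; [:: 6; 9]];
  [:: [:: 2; 4]; [:: 3; 7]; [:: 5]; [:: 6; 8]; [:: 9]];
  [:: [:: 2; 3]; [:: 4]; [:: 5; 6]; [:: 7]; [:: 8; 9]];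
  [:: [:: 2]; [:: 3]; [:: 4; 5; 6]; [:: 7; 8; 9]];
  [:: [:: 4]; [:: 7]; [:: 2; 5; 8]; [:: 3; 6; 9]];
  [:: [:: 2; 3]; [:: 4; 5; 6]; [:: 7; 8; 9]];
  [:: [:: 4; 7]; [:: 2; 5; 8]; [:: 3; 6; 9]];
  [:: [:: 2]; [:: 3]; [:: 4; 5; 6; 7; 8; 9]];
  [:: [:: 2; 3]; [:: 4; 7]; [:: 5; 6; 8; 9]];
  [:: [:: 4]; [:: 7]; [:: 2; 3; 5; 6; 8; 9]];
  [:: [:: 2; 3; 4; 7]; [:: 5; 6; 8; 9]];
  [:: [:: 2; 3]; [:: 4; 5; 6; 7; 8; 9]];
  [:: [:: 4; 7]; [:: 2; 3; 5; 6; 8; 9]]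
]%N].

Definition exceptional (R : realType) (k l r s : R) : Prop :=
  (k = r /\ s = -1) \/
  (l = -1 - s /\ r = 0) \/
  (k = l /\ s = -1 - r) \/
  [/\ k = s ^+ 2, l = - 2 * s & r = 1] \/
  [/\ k = 2 * (1 + r), l = (1 + r) ^+ 2 & s = -2] \/
  (k = 3 - s - r /\ l = 5 + s + r) \/
  [/\ k = r * (3 + r), l = 3 + r & s = -2] \/
  [/\ l = - k * (s + 1), k = 2 - s & r = 1] \/
  [/\ k = r * (2 * r + 1), l = (r - 1) * (2 * r + 1) & s = - r] \/
  [/\ k = (s + 2) * (2 * s + 1), l = (s + 1) * (2 * s + 1) & r = -2 - s].

(* The conditions are required to fail for both labellings of the two
   non-principal characters.  Under s <= r, [exceptional k l s r] adds to
   [exceptional k l r s] only the mirror images of the last two conditions.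
   They cannot be dropped: k = 15, l = 20, r = 3, s = -3 (the strongly regular
   graphs with parameters (36, 15, 6, 6)) does not satisfy
   [exceptional k l r s], yet 2468|3579 gives a fusion there. *)
Definition nonexceptional (R : realType) (k l r s : R) : Prop :=
  ~ exceptional k l r s /\ ~ exceptional k l s r.

Definition generic_sita3 (R : realType) (A : sita3 R) : Prop :=
  exists k l r s : R,
    [/\ has_character_table A k l r s, s <= r & nonexceptional k l r s].

(* Main.v *)
(** The algebra is determined by the valencies k, l and one more parameter
    0 <= x <= 1: A_1 A_2 = b A_1 + a A_2 with a = k x and b = l (1 - x), and the
    valency map together with the coefficient of 1 in triple products gives the
    other constants.  The eigenvalues satisfy r + s = a - b - 1 and r s = - a,
    so x = 0 and x = 1 are the conditions (b) and (a).

    A partition gives a fusion iff for all blocks S, T the coefficients of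
    C_S C_T are constant on every block.  Put u = x / (1 - x),
    lam = k - 1 - b >= 0 and mu = l - 1 - a >= 0, the coefficients of A_1 in
    A_1^2 and of A_2 in A_2^2.  Up to the factor 1 + u + u^2 all structure
    constants are polynomials in u, lam, mu with nonnegative coefficients.
    Whenever a difference of two coefficients of C_S C_T also has nonnegative
    coefficients and a term free of lam and mu, it is positive, so the
    corresponding blocks do not occur together.  A backtracking search over
    the blocks with this criterion leaves 46 partitions: the fifteen, which are
    fusions identically in k, l, x, and 31 others, for which a few of the
    equations force one of the exceptional conditions.  The algebra of the
    Petersen graph shows that the class of nonexceptional algebras is not
    empty. *)

From HB Require Import structures.
Require Import Defs.
From Stdlib Require Import ZArith.
From mathcomp Require Import all_boot all_order all_algebra all_field.
From mathcomp Require Import complex reals.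
From mathcomp Require Import ssrZ ring lra.

Set Implicit Arguments.
Unset Strict Implicit.
Unset Printing Implicit Defensive.

Import Order.TTheory GRing.Theory Num.Theory.
Local Open Scope ring_scope.

(** * Polynomials in three variables as nested lists *)

Section HornerLists.
Variables (C : Type) (c0 : C) (cadd cmul : C -> C -> C) (copp : C -> C).

(** Coefficients are listed from degree 0 upwards. The coefficient operations are parameters, so
    that three nested uses of the same code give polynomials in three variables over [Z]. *)
Fixpoint padd (p q : seq C) : seq C :=
  match p, q with
  | [::], _ => q
  | _, [::] => p
  | a :: p', b :: q' => cadd a b :: padd p' q'
  end.

Fixpoint pmul (p q : seq C) : seq C :=
  if p is a :: p' then padd (map (cmul a) q) (c0 :: pmul p' q) else [::].

Definition popp (p : seq C) : seq C := map copp p.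

Variables (R : realDomainType) (ev : C -> R) (x : R).
Hypotheses (ev0 : ev c0 = 0) (evD : forall a b, ev (cadd a b) = ev a + ev b)
  (evM : forall a b, ev (cmul a b) = ev a * ev b)
  (evN : forall a, ev (copp a) = - ev a).

Fixpoint peval (p : seq C) : R := if p is a :: p' then ev a + x * peval p' else 0.

Lemma peval_add p q : peval (padd p q) = peval p + peval q.
Proof.
elim: p q => [|a p IHp] [|b q] /=; rewrite ?add0r ?addr0 //.
by rewrite evD IHp; ring.
Qed.

Lemma peval_mul p q : peval (pmul p q) = peval p * peval q.
Proof.
have scale a : peval (map (cmul a) q) = ev a * peval q.
  by elim: q => [|b q IHq] /=; rewrite ?mulr0 // evM IHq; ring.
elim: p => [|a p IHp] /=; first by rewrite mul0r.
by rewrite peval_add /= IHp ev0 scale; ring.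
Qed.

Lemma peval_opp p : peval (popp p) = - peval p.
Proof. by elim: p => [|a p IHp] /=; rewrite ?oppr0 // evN IHp; ring. Qed.

Lemma peval_ge0 (nneg : pred C) p :
  0 <= x -> (forall a, nneg a -> 0 <= ev a) -> all nneg p -> 0 <= peval p.
Proof.
move=> x0 nnegP; elim: p => //= a p IHp /andP[/nnegP a0 /IHp p0].
by rewrite addr_ge0 ?mulr_ge0.
Qed.

Lemma peval_gt0 (nneg pos : pred C) p :
  0 < x -> (forall a, nneg a -> 0 <= ev a) -> (forall a, pos a -> 0 < ev a) ->
  all nneg p -> has pos p -> 0 < peval p.
Proof.
move=> x0 nnegP posP; elim: p => //= a p IHp /andP[a0 p0] /orP[/posP a1|p1].
  by rewrite ltr_wpDr // mulr_ge0 ?(peval_ge0 _ nnegP) // ltW.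
by rewrite ltr_wpDl ?nnegP // mulr_gt0 // IHp.
Qed.

(** For a variable that may vanish, the constant coefficient is what survives as a lower bound. *)
Lemma peval_head (nneg : pred C) p :
  0 <= x -> (forall a, nneg a -> 0 <= ev a) -> all nneg p ->
  ev (head c0 p) <= peval p.
Proof.
move=> x0 nnegP; case: p => [|a p] /=; first by rewrite ev0.
by move=> /andP[_ p0]; rewrite lerDl mulr_ge0 ?(peval_ge0 _ nnegP).
Qed.

End HornerLists.

Definition poly1 := seq Z.
Definition poly2 := seq poly1.
Definition poly3 := seq poly2.

Definition add3 : poly3 -> poly3 -> poly3 := padd (padd (padd Z.add)).
Definition mul3 : poly3 -> poly3 -> poly3 :=
  pmul [::] (padd (padd Z.add))
    (pmul [::] (padd Z.add) (pmul Z0 Z.add Z.mul)).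
Definition opp3 : poly3 -> poly3 := popp (popp (popp Z.opp)).
Definition sub3 p q := add3 p (opp3 q).
Definition const3 (n : nat) : poly3 := [:: [:: [:: Z.of_nat n]]].
Definition var1 : poly3 := [:: [:: [:: Z0; Z.one]]].
Definition var2 : poly3 := [:: [:: [::]; [:: Z.one]]].
Definition var3 : poly3 := [:: [::]; [:: [:: Z.one]]].

(* Terms containing the second or third variable do not count for strictness:
   these variables may vanish. *)
Definition positive3 (p : poly3) : bool :=
  all (all (all (Z.leb Z0))) p && has (Z.ltb Z0) (head [::] (head [::] p)).

(* [d] stands for 1, so that all constants can be multiplied by a common
   denominator.  [T] is a ring of numbers or of polynomials. *)
Section StructureConstants.
Variables (T : Type) (z : T) (sub mul : T -> T -> T) (d k l a b : T).

(** With A_1 A_2 = b A_1 + a A_2, the entries for A_1^2 and A_2^2 follow from A_i (A_0 + A_1 + A_2)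
    = delta(A_i) (A_0 + A_1 + A_2). *)
Definition sconst (i j h : nat) : T :=
  match i, j, h with
  | 0, 0, 0 | 0, 1, 1 | 1, 0, 1 | 0, 2, 2 | 2, 0, 2 => d
  | 1, 1, 0 => k | 1, 1, 1 => sub (sub k d) b | 1, 1, 2 => sub k a
  | 1, 2, 1 | 2, 1, 1 => b | 1, 2, 2 | 2, 1, 2 => a
  | 2, 2, 0 => l | 2, 2, 1 => sub l b | 2, 2, 2 => sub (sub l d) a
  | _, _, _ => z
  end%N.

Definition tconst (s t u : nat) : T :=
  mul (sconst (s.-1 %% 3) (t.-1 %% 3) (u.-1 %% 3))
      (sconst (s.-1 %/ 3) (t.-1 %/ 3) (u.-1 %/ 3)).
End StructureConstants.

Definition table := seq (seq (seq poly3)).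
(** The range 10 makes the labels 1 to 9 list positions; position 0 repeats label 1 because [0.-1]
    is 0. *)
Definition mktable (d k l a b : poly3) : table :=
  mkseq (fun s => mkseq (fun t => mkseq (fun u =>
    tconst [::] sub3 mul3 d k l a b s t u) 10) 10) 10.

(** * Products of block sums and the backtracking search *)

Section Products.
Variable tb : table.

Definition pprod (S T : seq nat) : seq poly3 :=
  foldr (fun s acc =>
    foldr (fun t => padd add3 (nth [::] (nth [::] tb s) t)) acc T) [::] S.

(** A certificate that [S], [T] and the members of [Us] are not all blocks of one fusion. Both
    orders of [a] and [b] are tried, so testing for a positive difference covers negative ones. *)
Definition clash S T (Us : seq (seq nat)) : bool :=
  let v := pprod S T in
  has (fun U => has (fun a => has (fun b =>
    positive3 (sub3 (nth [::] v a) (nth [::] v b))) U) U) Us.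

(** The blocks in [cur] were tested against each other when they were added. What remains are the
    products with factor [B] (one order, by commutativity) and the constancy of the older products
    on [B]. *)
Definition refuted (cur : seq (seq nat)) (B : seq nat) : bool :=
  has (fun S => clash S B (B :: cur)) (B :: cur)
  || has (fun S => has (fun T => clash S T [:: B]) cur) cur.

Fixpoint subseqs (s : seq nat) : seq (seq nat) :=
  if s is x :: s' then
    let r := subseqs s' in r ++ map (cons x) r else [:: [::]].

(** Always choosing the block through the least remaining label avoids visiting a partition twice.
    On exhausted fuel [cur] is returned as it is; [survivors] starts with 9 units for 8 labels. *)
Fixpoint search (fuel : nat) (good cur : seq (seq nat)) (rem : seq nat) :
    seq (seq (seq nat)) :=
  if fuel is fuel'.+1 then
    if rem is m :: rem' then
      flatten [seq search fuel' good (B :: cur) [seq t <- rem | t \notin B]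
        | B <- good & [&& m \in B, all (mem rem) B & ~~ refuted cur B]]
    else [:: cur]
  else [:: cur].

Definition survivors :=
  let good := [seq B <- subseqs (iota 2 8) | ~~ clash B B [:: B]] in
  search 9 good [::] (iota 2 8).
End Products.

(* The variables are u, lam, mu; p and q are a and b times 1 + u + u^2. *)
Definition utable : table :=
  let u := var1 in let c := const3 in
  let p := add3 (add3 (c 2%N) u) (add3 var3 (mul3 (add3 (c 1%N) u) var2)) in
  let q := add3 (add3 (c 1%N) (mul3 (c 2%N) u))
             (add3 (mul3 u var2) (mul3 (add3 (c 1%N) u) var3)) in
  mktable (add3 (add3 (c 1%N) u) (mul3 u u))
    (mul3 (add3 (c 1%N) u) p) (mul3 (add3 (c 1%N) u) q) (mul3 u p) q.

(** * Evaluation of the polynomials and the positivity criterion *)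

Section Evaluation.
Variables (R : realFieldType) (x1 x2 x3 : R).

Definition zval (z : Z) : R := (int_of_Z z)%:~R.
Definition eval3 : poly3 -> R := peval (peval (peval zval x1) x2) x3.

Lemma zvalD a b : zval (Z.add a b) = zval a + zval b.
Proof. by rewrite /zval (rmorphD int_of_Z) rmorphD. Qed.
Lemma zvalM a b : zval (Z.mul a b) = zval a * zval b.
Proof. by rewrite /zval (rmorphM int_of_Z) rmorphM. Qed.
Lemma zvalN a : zval (Z.opp a) = - zval a.
Proof. by rewrite /zval (rmorphN int_of_Z) rmorphN. Qed.

Lemma eval3D p q : eval3 (add3 p q) = eval3 p + eval3 q.
Proof.
by do 2![apply: peval_add => *]; apply: peval_add; apply: zvalD.
Qed.

Lemma eval3M p q : eval3 (mul3 p q) = eval3 p * eval3 q.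
Proof.
apply: peval_mul => // [a b|a b].
  by apply: peval_add => *; apply: peval_add; apply: zvalD.
apply: peval_mul => // [c d|c d]; first by apply: peval_add; apply: zvalD.
by apply: peval_mul => //; [apply: zvalD|apply: zvalM].
Qed.

Lemma eval3N p : eval3 (opp3 p) = - eval3 p.
Proof.
by do 2![apply: peval_opp => *]; apply: peval_opp; apply: zvalN.
Qed.

Lemma eval3B p q : eval3 (sub3 p q) = eval3 p - eval3 q.
Proof. by rewrite eval3D eval3N. Qed.

Lemma eval3C n : eval3 (const3 n) = n%:R.
Proof.
rewrite /eval3 /= /zval !mulr0 !addr0; case: n => [|n] //=.
by rewrite SuccNat2Pos.id_succ.
Qed.

Lemma eval3_var1 : eval3 var1 = x1.
Proof. by rewrite /eval3 /= -[zval Z0]/0 -[zval Z.one]/1; ring. Qed.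
Lemma eval3_var2 : eval3 var2 = x2.
Proof. by rewrite /eval3 /= -[zval Z.one]/1; ring. Qed.
Lemma eval3_var3 : eval3 var3 = x3.
Proof. by rewrite /eval3 /= -[zval Z.one]/1; ring. Qed.

Definition eval3E :=
  (eval3B, eval3D, eval3M, eval3C, eval3_var1, eval3_var2, eval3_var3).

(** The value is at least that of the terms free of the third variable, which is at least that of
    the terms free of the second as well. The latter form a polynomial in [x1] with nonnegative
    coefficients, one of them positive. *)
Lemma eval3_positive p : 0 < x1 -> 0 <= x2 -> 0 <= x3 ->
  positive3 p -> 0 < eval3 p.
Proof.
move=> x1_gt0 x2_ge0 x3_ge0 /andP[p_ge0 p_gt0].
have z_ge0 a : Z.leb Z0 a -> 0 <= zval a by case: a.
have z_gt0 a : Z.ltb Z0 a -> 0 < zval a.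
  by case: a => // a _; rewrite ltr0n; apply/ssrnat.ltP/Pos2Nat.is_pos.
have ge0_1 (q : poly1) : all (Z.leb Z0) q -> 0 <= peval zval x1 q.
  by apply: peval_ge0 => //; apply: ltW.
have ge0_2 (q : poly2) : all (all (Z.leb Z0)) q -> 0 <= peval (peval zval x1) x2 q.
  exact: peval_ge0.
have all_head q : all (all (all (Z.leb Z0))) q -> all (all (Z.leb Z0)) (head [::] q).
  by case: q => //= c q /andP[].
have h2 := all_head _ p_ge0.
have h1 : all (Z.leb Z0) (head [::] (head [::] p)).
  by case: (head _ _) h2 => //= c q /andP[].
apply: lt_le_trans (peval_gt0 x1_gt0 z_ge0 z_gt0 h1 p_gt0) _.
apply: le_trans (peval_head _ x2_ge0 ge0_1 h2) _ => //.
exact: (peval_head _ x3_ge0 ge0_2 p_ge0).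
Qed.

End Evaluation.

(** * Coefficients of products in the tensor square *)

Section TensorCoefficients.
Variable R : realFieldType.

Definition sconstR (d k l a b : R) := sconst 0 (fun x y => x - y) d k l a b.
Definition tconstR (d k l a b : R) :=
  tconst 0 (fun x y => x - y) *%R d k l a b.

Definition tcoef (k l x : R) (S T : seq nat) (u : nat) : R :=
  \sum_(s <- S) \sum_(t <- T) tconstR 1 k l (k * x) (l * (1 - x)) s t u.

(** The structure constants of the algebra are linear forms in d, k, l, a, b, and those of the
    tensor square are products of two of them. *)
Lemma tconst_scale (c d k l a b : R) s t u :
  tconstR (c * d) (c * k) (c * l) (c * a) (c * b) s t u =
  c ^+ 2 * tconstR d k l a b s t u.
Proof.
have scale i j h : sconstR (c * d) (c * k) (c * l) (c * a) (c * b) i j h =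
    c * sconstR d k l a b i j h.
  by case: i => [|[|[|i]]]; case: j => [|[|[|j]]]; case: h => [|[|[|h]]];
     rewrite /sconstR /= ?mulr0 //; ring.
by rewrite /tconstR /tconst -!/(sconstR _ _ _ _ _ _ _ _) !scale; ring.
Qed.

Lemma eval3_tconst x1 x2 x3 d k l a b s t u :
  let ev := eval3 x1 x2 x3 in
  ev (tconst [::] sub3 mul3 d k l a b s t u) =
  tconstR (ev d) (ev k) (ev l) (ev a) (ev b) s t u.
Proof.
move=> ev; rewrite /tconstR /tconst {1}/ev eval3M -/ev.
have evs i j h : ev (sconst [::] sub3 d k l a b i j h) =
    sconstR (ev d) (ev k) (ev l) (ev a) (ev b) i j h.
  by case: i => [|[|[|i]]]; case: j => [|[|[|j]]]; case: h => [|[|[|h]]];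
     rewrite /sconstR /ev //= ?eval3B.
by rewrite !evs.
Qed.

Lemma eval3_pprod x1 x2 x3 d k l a b (S T : seq nat) u :
  let ev := eval3 x1 x2 x3 in
  all (ltn^~ 10) S -> all (ltn^~ 10) T -> (u < 10)%N ->
  ev (nth [::] (pprod (mktable d k l a b) S T) u) =
  \sum_(s <- S) \sum_(t <- T)
    tconstR (ev d) (ev k) (ev l) (ev a) (ev b) s t u.
Proof.
move=> ev S10 T10 u10.
have nth_add (v w : seq poly3) : ev (nth [::] (padd add3 v w) u) =
    ev (nth [::] v u) + ev (nth [::] w u).
  elim: v w u {u10} => [|p v IHv] [|q w] [|u] //=;
    rewrite ?add0r ?addr0 //; exact: eval3D.
elim: S S10 => [|s S IHS] /=; first by rewrite big_nil nth_nil.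
move=> /andP[s10 /IHS]; rewrite big_cons => <-.
rewrite -/(pprod _ S T); move: (pprod _ S T) => acc.
elim: T T10 {IHS} => [|t T IHT] /=; first by rewrite big_nil add0r.
move=> /andP[t10 /IHT IH]; rewrite nth_add big_cons -addrA -IH.
by rewrite !nth_mkseq // /ev eval3_tconst.
Qed.

Definition fused (k l x : R) (blk : seq nat -> Prop) :=
  forall S T U a b, blk S -> blk T -> blk U -> a \in U -> b \in U ->
  tcoef k l x S T a = tcoef k l x S T b.

(* The variables are k, l, x. *)
Definition xtable : table :=
  mktable (const3 1) var1 var2 (mul3 var1 var3)
    (mul3 var2 (sub3 (const3 1) var3)).

(** While [utable] decides signs, these differences in k, l, x give the exact equations that a
    fusion imposes. *)
Definition coef_diff (S T : seq nat) (a b : nat) : poly3 :=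
  let v := pprod xtable S T in sub3 (nth [::] v a) (nth [::] v b).

Lemma eval3_xtable (k l x : R) S T u :
  all (ltn^~ 10) S -> all (ltn^~ 10) T -> (u < 10)%N ->
  eval3 k l x (nth [::] (pprod xtable S T) u) = tcoef k l x S T u.
Proof.
move=> S10 T10 u10; rewrite eval3_pprod //; apply: eq_bigr => s _.
apply: eq_bigr => t _; by rewrite !eval3E.
Qed.

(** The relations k = lam + 1 + l (1 - x) and l = mu + 1 + k x are linear in k and l. Solving them
    with x = w / (1 + w) produces the denominator 1 + w + w^2, which enters squared by
    [tconst_scale]. *)
Lemma eval3_utable (k l x : R) S T u :
  let lam := k - 1 - l * (1 - x) in let mu := l - 1 - k * x in
  let w := x / (1 - x) in
  x != 1 -> all (ltn^~ 10) S -> all (ltn^~ 10) T -> (u < 10)%N ->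
  eval3 w lam mu (nth [::] (pprod utable S T) u) =
  (1 + w + w ^+ 2) ^+ 2 * tcoef k l x S T u.
Proof.
move=> lam mu w x1 S10 T10 u10; rewrite eval3_pprod // mulr_sumr.
apply: eq_bigr => s _; rewrite mulr_sumr; apply: eq_bigr => t _.
rewrite -tconst_scale !eval3E.
have y0 : 1 - x != 0 by rewrite subr_eq0 eq_sym.
by congr tconstR; rewrite /w /lam /mu; field.
Qed.

Lemma clashP (k l x : R) S T Us :
  0 < x < 1 -> 0 <= k - 1 - l * (1 - x) -> 0 <= l - 1 - k * x ->
  all (ltn^~ 10) S -> all (ltn^~ 10) T -> all (all (ltn^~ 10)) Us ->
  clash utable S T Us ->
  exists U a b, [/\ U \in Us, a \in U, b \in U
    & tcoef k l x S T a != tcoef k l x S T b].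
Proof.
move=> /andP[x0 x1] lam0 mu0 S10 T10 /allP U10.
case/hasP=> U UsU /hasP[a Ua /hasP[b Ub pos]]; exists U, a, b; split=> //.
have /allP U10' := U10 _ UsU.
have a10 : (a < 10)%N := U10' _ Ua.
have b10 : (b < 10)%N := U10' _ Ub.
have w0 : 0 < x / (1 - x) by rewrite divr_gt0 // subr_gt0.
have := eval3_positive w0 lam0 mu0 pos.
have xN1 : x != 1 by rewrite lt_eqF.
rewrite eval3B !eval3_utable // -mulrBr => gt0.
by apply/eqP => e; move: gt0; rewrite e subrr mulr0 ltxx.
Qed.

End TensorCoefficients.

(** * Search over block systems *)

Section Search.
Variables (R : realFieldType) (k l x : R) (blk : seq nat -> Prop).
Hypotheses (x01 : 0 < x < 1) (lam_ge0 : 0 <= k - 1 - l * (1 - x))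
  (mu_ge0 : 0 <= l - 1 - k * x) (blk_fused : fused k l x blk)
  (blk_subseqs : forall B, blk B -> B \in subseqs (iota 2 8))
  (blk_cover : forall m, m \in iota 2 8 -> exists2 B, blk B & m \in B)
  (blk_disj : forall B B' t, blk B -> blk B' -> t \in B -> t \in B' -> B = B').

Lemma subseqs_sub s t : t \in subseqs s -> {subset t <= s}.
Proof.
elim: s t => [|a s IHs] t /=; first by rewrite inE => /eqP->.
rewrite mem_cat => /orP[/IHs sts u /sts|/mapP[r /IHs srs -> u]].
  by rewrite inE orbC => ->.
by rewrite !inE => /orP[->//|/srs->]; rewrite orbT.
Qed.

Lemma blk_sub B : blk B -> {subset B <= iota 2 8}.
Proof. by move=> /blk_subseqs/subseqs_sub. Qed.

Lemma blk_lt10 B : blk B -> all (ltn^~ 10) B.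
Proof. by move=> /blk_sub sB; apply/allP=> t /sB; rewrite mem_iota => /andP[]. Qed.

Lemma blk_noclash S T Us :
  blk S -> blk T -> (forall U, U \in Us -> blk U) -> ~~ clash utable S T Us.
Proof.
move=> bS bT bUs; apply/negP => h.
have Us10 : all (all (ltn^~ 10)) Us by apply/allP=> U /bUs/blk_lt10.
have [U [a [b [/bUs bU Ua Ub /eqP]]]] :=
  clashP x01 lam_ge0 mu_ge0 (blk_lt10 bS) (blk_lt10 bT) Us10 h.
by apply; exact: (blk_fused bS bT bU Ua Ub).
Qed.

Lemma blk_not_refuted cur B :
  (forall S, S \in cur -> blk S) -> blk B -> ~~ refuted utable cur B.
Proof.
move=> bcur bB.
have bBcur S : S \in B :: cur -> blk S by rewrite inE => /orP[/eqP->|/bcur].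
rewrite negb_or; apply/andP; split; apply/hasPn => S SB.
  by apply: blk_noclash => //; apply: bBcur.
apply/hasPn => T Tc; apply: blk_noclash; [exact: bcur|exact: bcur|].
by move=> U; rewrite inE => /eqP->.
Qed.

(** The branch that picks the true block through the next label is never pruned, since true blocks
    do not clash. The invariant is that [cur] holds true blocks and [rem] is exactly what they leave
    uncovered. *)
Lemma search_complete n good cur rem :
  (size rem < n)%N -> (forall B, blk B -> B \in good) ->
  (forall S, S \in cur -> blk S) ->
  {subset rem <= iota 2 8} ->
  (forall t, t \in iota 2 8 -> t \in rem = ~~ has (fun S => t \in S) cur) ->
  exists P, [/\ P \in search utable n good cur rem,
    forall S, S \in P -> blk S
  & forall t, t \in iota 2 8 -> has (fun S => t \in S) P].
Proof.
move=> + bgood; elim: n cur rem => // n IHn cur [|m rem'] sz bcur srem remP.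
  exists cur; split=> //=; first by rewrite inE.
  by move=> t /remP; rewrite in_nil => /esym/negbFE.
set rem := m :: rem' in sz srem remP *.
have [B bB mB] := blk_cover (srem m (mem_head _ _)).
have sB : {subset B <= rem}.
  move=> t tB; rewrite remP ?(blk_sub bB) //; apply/hasPn => S Sc.
  apply/negP => tS; have BS := blk_disj bB (bcur S Sc) tB tS.
  have := remP m (srem m (mem_head _ _)); rewrite mem_head => /esym/hasPn/(_ S Sc).
  by rewrite -BS mB.
have [||||P [Psearch bP covP]] :=
    IHn (B :: cur) [seq t <- rem | t \notin B].
(* The label [m] lies in [B], so at least one label is removed for each unit of fuel. *)
- apply: leq_ltn_trans (_ : size rem' < n)%N => //.
  by rewrite /rem /= mB /= size_filter count_size.
- by move=> S; rewrite inE => /orP[/eqP->|/bcur].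
- by move=> t; rewrite mem_filter => /andP[_ /srem].
- by move=> t t28; rewrite mem_filter remP //= negb_or.
- exists P; split=> //; apply/flattenP.
  exists (search utable n good (B :: cur) [seq t <- rem | t \notin B]) => //.
  apply/mapP; exists B => //; rewrite mem_filter bgood // mB andbT /=.
  by rewrite (blk_not_refuted bcur bB) andbT; apply/allP => t /sB.
Qed.

Lemma survivors_complete : exists P, [/\ P \in survivors utable,
    forall S, S \in P -> blk S
  & forall t, t \in iota 2 8 -> has (fun S => t \in S) P].
Proof.
apply: search_complete => // B bB.
rewrite mem_filter blk_subseqs // andbT.
by apply: blk_noclash => // U; rewrite inE => /eqP->.
Qed.
End Search.

Definition generic_blocks : seq (seq (seq nat)) := [::
  [:: [:: 2]; [:: 3]; [:: 4]; [:: 5]; [:: 6]; [:: 7]; [:: 8]; [:: 9]];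
  [:: [:: 2; 3; 4; 5; 6; 7; 8; 9]];
  [:: [:: 2]; [:: 3]; [:: 4; 7]; [:: 5; 8]; [:: 6; 9]];
  [:: [:: 2; 4]; [:: 3; 7]; [:: 5]; [:: 6; 8]; [:: 9]];
  [:: [:: 2; 3]; [:: 4]; [:: 5; 6]; [:: 7]; [:: 8; 9]];
  [:: [:: 2]; [:: 3]; [:: 4; 5; 6]; [:: 7; 8; 9]];
  [:: [:: 4]; [:: 7]; [:: 2; 5; 8]; [:: 3; 6; 9]];
  [:: [:: 2; 3]; [:: 4; 5; 6]; [:: 7; 8; 9]];
  [:: [:: 4; 7]; [:: 2; 5; 8]; [:: 3; 6; 9]];
  [:: [:: 2]; [:: 3]; [:: 4; 5; 6; 7; 8; 9]];
  [:: [:: 2; 3]; [:: 4; 7]; [:: 5; 6; 8; 9]];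
  [:: [:: 4]; [:: 7]; [:: 2; 3; 5; 6; 8; 9]];
  [:: [:: 2; 3; 4; 7]; [:: 5; 6; 8; 9]];
  [:: [:: 2; 3]; [:: 4; 5; 6; 7; 8; 9]];
  [:: [:: 4; 7]; [:: 2; 3; 5; 6; 8; 9]]
]%N.

Lemma fifteenE : fifteen = map of_blocks generic_blocks.
Proof. by []. Qed.

Definition special_blocks : seq (seq (seq nat)) := [::
  [:: [:: 2; 3]; [:: 4; 7]; [:: 5; 9]; [:: 6; 8]];
  [:: [:: 2; 3]; [:: 4; 5; 7; 9]; [:: 6; 8]];
  [:: [:: 2; 3]; [:: 4; 6; 7; 8]; [:: 5; 9]];
  [:: [:: 2; 7]; [:: 3; 4]; [:: 5; 9]; [:: 6]; [:: 8]];
  [:: [:: 2; 7]; [:: 3; 4; 8]; [:: 5; 9]; [:: 6]];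
  [:: [:: 2; 6; 7]; [:: 3; 4]; [:: 5; 9]; [:: 8]];
  [:: [:: 2; 3; 4; 7]; [:: 5; 9]; [:: 6; 8]];
  [:: [:: 2; 3; 5; 9]; [:: 4; 7]; [:: 6; 8]];
  [:: [:: 2; 3; 6; 8]; [:: 4; 7]; [:: 5; 9]];
  [:: [:: 2; 3; 5; 9]; [:: 4; 6; 7; 8]];
  [:: [:: 2; 3; 6; 8]; [:: 4; 5; 7; 9]];
  [:: [:: 2; 6]; [:: 3; 8]; [:: 4; 9]; [:: 5; 7]];
  [:: [:: 2; 9]; [:: 3; 5]; [:: 4; 8]; [:: 6; 7]];
  [:: [:: 2; 4; 9]; [:: 3; 5; 7]; [:: 6; 8]];
  [:: [:: 2; 6; 7]; [:: 3; 4; 8]; [:: 5; 9]];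
  [:: [:: 2; 6; 7]; [:: 3; 4; 5; 8; 9]];
  [:: [:: 2; 5; 6; 7; 9]; [:: 3; 4; 8]];
  [:: [:: 2; 3; 4; 5; 7; 9]; [:: 6; 8]];
  [:: [:: 2; 3; 4; 6; 7; 8]; [:: 5; 9]];
  [:: [:: 2; 3]; [:: 4; 5; 9]; [:: 6; 7; 8]];
  [:: [:: 2; 3]; [:: 4; 6; 8]; [:: 5; 7; 9]];
  [:: [:: 2; 5; 9]; [:: 3; 6; 8]; [:: 4; 7]];
  [:: [:: 2; 6; 8]; [:: 3; 5; 9]; [:: 4; 7]];
  [:: [:: 2; 5; 7; 9]; [:: 3; 4; 6; 8]];
  [:: [:: 2; 6; 7; 8]; [:: 3; 4; 5; 9]];
  [:: [:: 2; 4]; [:: 3; 5; 7]; [:: 6; 8]; [:: 9]];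
  [:: [:: 2; 4; 9]; [:: 3; 7]; [:: 5]; [:: 6; 8]];
  [:: [:: 2; 4; 9]; [:: 3; 5; 6; 7; 8]];
  [:: [:: 2; 4; 6; 8; 9]; [:: 3; 5; 7]];
  [:: [:: 2; 4; 5; 9]; [:: 3; 6; 7; 8]];
  [:: [:: 2; 4; 6; 8]; [:: 3; 5; 7; 9]]
]%N.

(** The search runs here by evaluation. It conses new blocks in front, hence the comparison up to
    the order of blocks. *)
Lemma survivorsE : all (fun P => has (perm_eq P) (generic_blocks ++ special_blocks))
  (survivors utable).
Proof. by lazy. Qed.

Section FusedEquations.
Variables (R : realFieldType) (k l x : R).

Lemma coef_diff_fused P S T U a b :
  fused k l x (fun B => B \in P) -> all (all (ltn^~ 10)) P ->
  S \in P -> T \in P -> U \in P -> a \in U -> b \in U ->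
  eval3 k l x (coef_diff S T a b) = 0.
Proof.
move=> fP /allP P10 SP TP UP Ua Ub; have /allP U10 := P10 _ UP.
have a10 : (a < 10)%N := U10 _ Ua; have b10 : (b < 10)%N := U10 _ Ub.
rewrite eval3B !eval3_xtable ?P10 //; apply/eqP; rewrite subr_eq0; apply/eqP.
exact: (fP S T U).
Qed.

(** The lists are not normalized, so the zero polynomial is recognized by the vanishing of every
    coefficient. *)
Definition fused_diffs (P : seq (seq nat)) : bool :=
  all (fun S => all (fun T => all (fun U => all (fun a => all (fun b =>
    all (all (all (Z.eqb Z0))) (coef_diff S T a b)) U) U) P) P) P.

Lemma generic_fused P : P \in generic_blocks -> fused k l x (fun B => B \in P).
Proof.
have : all (fun P => all (all (ltn^~ 10)) P && fused_diffs P) generic_blocks by lazy.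
move=> /allP gen /gen /andP[/allP P10 diffs] S T U a b SP TP UP Ua Ub.
move/allP/(_ _ SP)/allP/(_ _ TP)/allP/(_ _ UP)/allP/(_ _ Ua)/allP/(_ _ Ub): diffs.
have /allP U10 := P10 _ UP.
have a10 : (a < 10)%N := U10 _ Ua; have b10 : (b < 10)%N := U10 _ Ub.
move=> z; apply/eqP; rewrite -subr_eq0 -!eval3_xtable ?P10 // -eval3B.
have z1 (p : poly1) : all (Z.eqb Z0) p -> peval (@zval R) k p = 0.
  by elim: p => //= -[] //= p IHp /IHp->; rewrite mulr0 addr0.
have z2 (p : poly2) : all (all (Z.eqb Z0)) p -> peval (peval (@zval R) k) l p = 0.
  by elim: p => //= c p IHp /andP[/z1 -> /IHp->]; rewrite mulr0 addr0.
apply/eqP; move: z; rewrite -/(coef_diff S T a b) /eval3.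
by elim: (coef_diff _ _ _ _) => //= c p IHp /andP[/z2-> /IHp->]; rewrite mulr0 addr0.
Qed.

End FusedEquations.

(** Computes the difference of the coefficients of C_a and C_b in C_S C_T and states its vanishing
    as an explicit equation in k, l, x. The arguments [isT] settle the membership conditions by
    computation. *)
Ltac fused_equation E fP S T U a b :=
  have E := @coef_diff_fused _ _ _ _ _ S T U a b fP isT isT isT isT isT isT;
  let p := eval vm_compute in (coef_diff S T a b) in
  change (coef_diff S T a b) with p in E;
  rewrite /eval3 /zval /= /Pos.to_nat /= in E.

(** * The partitions left by the search *)

(** With w = l x, the first two equations give k = l (l + 1 - w^2) and (w - 2)(l - (w^2 + w + 1)) =
    0. If the second factor vanishes, the third equation becomes 2 w (w + 1)(2 - w) = 0, so w = 2 in
    both cases. *)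
Lemma cubic_system (R : realFieldType) (k l x : R) : 0 < l -> 0 < x ->
  k * (1 - l * x) = l * (3 - l) ->
  k * l * x + k * x - k + l ^+ 2 * x ^+ 2 - l ^+ 2 + l + 2 = 0 ->
  k ^+ 2 * x ^+ 2 - 2 * k * l * x + 6 * k * x - k - l ^+ 2 * x + l ^+ 2
    - l * x - l + 2 = 0 ->
  l * x = 2 /\ k = l * (l - 3).
Proof.
move=> l0 x0 e1 e2 e3; pose w := l * x; have w0 : 0 < w by exact: mulr_gt0.
have f1 : k * w = l * (2 * l - 2 - w ^+ 2).
  have : l * (k * (1 - w)) = l * (l * (3 - l)) by rewrite e1.
  have : l * (k * l * x + k * x - k + l ^+ 2 * x ^+ 2 - l ^+ 2 + l + 2) = 0.
    by rewrite e2 mulr0.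
  by rewrite /w => *; lra.
have f2 : k = l * (l + 1 - w ^+ 2) by rewrite -/w in e1; lra.
have f3 : l * ((w - 2) * (l - (w ^+ 2 + w + 1))) = 0.
  by rewrite {1}f2 in f1; lra.
have w2 : w = 2.
  move/eqP: f3; rewrite mulf_eq0 gt_eqF //= mulf_eq0 !subr_eq0.
  case/orP=> /eqP // f3.
  have f4 : k * x = w * (w + 2).
    have -> : k * x = w * (l + 1 - w ^+ 2) by rewrite f2 /w; ring.
    by rewrite f3; ring.
  have f5 : k = (w ^+ 2 + w + 1) * (w + 2) by rewrite f2 f3; ring.
  have : 2 * w * (w + 1) * (2 - w) = 0.
    rewrite -e3.
    have -> : k ^+ 2 * x ^+ 2 - 2 * k * l * x + 6 * k * x - k - l ^+ 2 * x
      + l ^+ 2 - l * x - l + 2 = (k * x) ^+ 2 - 2 * k * w + 6 * (k * x) - k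
      - l * w + l ^+ 2 - w - l + 2 by rewrite /w; ring.
    by rewrite f4 f5 f3; ring.
  have p : 0 < 2 * w * (w + 1) by rewrite !mulr_gt0 //; lra.
  by move/eqP; rewrite mulf_eq0 (gt_eqF p) /= subr_eq0 => /eqP.
by split=> //; rewrite f2 w2; ring.
Qed.

Section SpecialPartitions.
Variables (R : realFieldType) (k l x : R).
Hypotheses (k_gt0 : 0 < k) (l_gt0 : 0 < l) (x01 : 0 < x < 1)
  (lam_ge0 : 0 <= k - 1 - l * (1 - x)) (mu_ge0 : 0 <= l - 1 - k * x).

(* The letters are those of the exceptional conditions, expressed by k, l,
   a = k x and b = l (1 - x). *)
Variant special_case : Prop :=
| SpecialC of k = l & x = 2^-1
| SpecialD m of k = m ^+ 2 & l = 2 * m & k * x = m & l * (1 - x) = 2 * (m - 1)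
| SpecialE m of k = 2 * m & l = m ^+ 2 & k * x = 2 * (m - 1) & l * (1 - x) = m
| SpecialG of k = l * (l - 3) & k * x = 2 * (l - 3) & l * (1 - x) = l - 2
| SpecialH of l = k * (k - 3) & k * x = k - 2 & l * (1 - x) = 2 * (k - 3)
| SpecialI q of k = q * (2 * q + 1) & l = (q - 1) * (2 * q + 1)
    & k * x = q ^+ 2 & l * (1 - x) = q ^+ 2 - 1
| SpecialJ q of k = (q + 2) * (2 * q + 1) & l = (q + 1) * (2 * q + 1)
    & k * x = q * (q + 2) & l * (1 - x) = (q + 1) ^+ 2.

Lemma special_bounds : [/\ 0 < x, x < 1, 1 < k & 1 < l].
Proof.
have /andP[x0 x1] := x01; have y0 : 0 < 1 - x by lra.
have kx0 := mulr_gt0 k_gt0 x0; have ly0 := mulr_gt0 l_gt0 y0.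
have lam := lam_ge0; have mu := mu_ge0.
by split=> //; lra.
Qed.

Lemma special_half : k = l -> k * x + l * x - l = 0 -> special_case.
Proof.
move=> e1 e2; have [x0 x1 k1 l1] := special_bounds; apply: SpecialC => //.
have : l * (2 * x - 1) = 0 by rewrite -e2 e1; ring.
by move/eqP; rewrite mulf_eq0 gt_eqF //= => /eqP ?; lra.
Qed.

(** Both equations are linear in x. Eliminating x leaves k - l times a factor that is positive
    because k and l exceed 1. *)
Lemma special_two_ratios :
  x * (2 * k * l + k + l) = k * l - k + 2 * l ->
  x * (k ^+ 2 + k + l ^+ 2 + l) = l ^+ 2 + l -> special_case.
Proof.
move=> e1 e2; have [x0 x1 k1 l1] := special_bounds.
have : (k - l) * ((k * l - 1) * (k + l) - (k - l) ^+ 2) = 0.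
  have -> : (k - l) * ((k * l - 1) * (k + l) - (k - l) ^+ 2) =
      (k * l - k + 2 * l) * (k ^+ 2 + k + l ^+ 2 + l)
      - (l ^+ 2 + l) * (2 * k * l + k + l) by ring.
  by rewrite -e1 -e2; ring.
have pos : 0 < (k * l - 1) * (k + l) - (k - l) ^+ 2.
  have -> : (k * l - 1) * (k + l) - (k - l) ^+ 2 =
      (k - 1) * (l - 1) * (k + l + 4) + 2 * (k + l - 2) by ring.
  by apply: addr_gt0; rewrite !mulr_gt0 //; lra.
move/eqP; rewrite mulf_eq0 (gt_eqF pos) orbF subr_eq0 => /eqP kl.
have : (l + 1) * (k * x + l * x - l) = 0 by rewrite kl in e2 *; lra.
move/eqP; rewrite mulf_eq0 gt_eqF /=; last lra.
by move/eqP; apply: special_half.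
Qed.

(** Each partition is settled by two or three equalities of coefficients, most often after [cancel]
    has removed a positive factor. The last six partitions give cases E, D, G, H, J and I; the
    others give case C or a contradiction. *)
Lemma special_blocks_case P :
  P \in special_blocks -> fused k l x (fun B => B \in P) -> special_case.
Proof.
have [x0 x1 k1 l1] := special_bounds.
have cancel (c d : R) : 0 < c -> c * d = 0 -> d = 0.
  by move=> c0 /eqP; rewrite mulf_eq0 gt_eqF //= => /eqP.
have kl0 : 0 < k + l by lra.
have kl1 : 0 < k + l + 1 by lra.
have y0 : 0 < 1 - x by lra.
have kx0 : 0 < k * x by exact: mulr_gt0.
have lx0 : 0 < l * x by exact: mulr_gt0.
have ky0 : 0 < k * (1 - x) by exact: mulr_gt0.
have ly0 : 0 < l * (1 - x) by exact: mulr_gt0.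
rewrite /special_blocks.
case/predU1P=> [-> fP|].
  fused_equation E1 fP [:: 2; 3]%N [:: 5; 9]%N [:: 4; 7]%N 4%N 7%N.
  fused_equation E2 fP [:: 5; 9]%N [:: 6; 8]%N [:: 2; 3]%N 2%N 3%N.
  apply: special_half; first lra.
  by apply: (cancel (k + l)) => //; lra.
case/predU1P=> [-> fP|].
  fused_equation E1 fP [:: 2; 3]%N [:: 4; 5; 7; 9]%N [:: 4; 5; 7; 9]%N 4%N 7%N.
  fused_equation E2 fP [:: 4; 5; 7; 9]%N [:: 6; 8]%N [:: 4; 5; 7; 9]%N 4%N 7%N.
  apply: special_half; first lra.
  by apply: (cancel (k + l)) => //; lra.
case/predU1P=> [-> fP|].
  fused_equation E1 fP [:: 2; 3]%N [:: 4; 6; 7; 8]%N [:: 4; 6; 7; 8]%N 4%N 7%N.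
  fused_equation E2 fP [:: 4; 6; 7; 8]%N [:: 5; 9]%N [:: 4; 6; 7; 8]%N 4%N 7%N.
  apply: special_half; first lra.
  by apply: (cancel (k + l)) => //; lra.
case/predU1P=> [-> fP|].
  fused_equation E1 fP [:: 2; 7]%N [:: 5; 9]%N [:: 3; 4]%N 3%N 4%N.
  fused_equation E2 fP [:: 2; 7]%N [:: 3; 4]%N [:: 2; 7]%N 2%N 7%N.
  by apply: special_half; lra.
case/predU1P=> [-> fP|].
  fused_equation E1 fP [:: 2; 7]%N [:: 5; 9]%N [:: 3; 4; 8]%N 3%N 4%N.
  fused_equation E2 fP [:: 2; 7]%N [:: 3; 4; 8]%N [:: 3; 4; 8]%N 3%N 4%N.
  by apply: special_half; lra.
case/predU1P=> [-> fP|].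
  fused_equation E1 fP [:: 2; 6; 7]%N [:: 8]%N [:: 2; 6; 7]%N 2%N 7%N.
  fused_equation E2 fP [:: 2; 6; 7]%N [:: 3; 4]%N [:: 2; 6; 7]%N 2%N 7%N.
  by apply: special_half; lra.
case/predU1P=> [-> fP|].
  fused_equation E1 fP [:: 2; 3; 4; 7]%N [:: 5; 9]%N [:: 2; 3; 4; 7]%N 2%N 3%N.
  fused_equation E2 fP [:: 5; 9]%N [:: 6; 8]%N [:: 2; 3; 4; 7]%N 2%N 3%N.
  apply: special_half; first lra.
  by apply: (cancel (k + l)) => //; lra.
case/predU1P=> [-> fP|].
  fused_equation E1 fP [:: 2; 3; 5; 9]%N [:: 4; 7]%N [:: 2; 3; 5; 9]%N 2%N 3%N.
  fused_equation E2 fP [:: 2; 3; 5; 9]%N [:: 6; 8]%N [:: 2; 3; 5; 9]%N 2%N 3%N.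
  apply: special_half; first lra.
  by apply: (cancel (k + l)) => //; lra.
case/predU1P=> [-> fP|].
  fused_equation E1 fP [:: 2; 3; 6; 8]%N [:: 4; 7]%N [:: 2; 3; 6; 8]%N 2%N 3%N.
  fused_equation E2 fP [:: 2; 3; 6; 8]%N [:: 5; 9]%N [:: 2; 3; 6; 8]%N 2%N 3%N.
  apply: special_half; first lra.
  by apply: (cancel (k + l)) => //; lra.
case/predU1P=> [-> fP|].
  fused_equation E1 fP [:: 2; 3; 5; 9]%N [:: 2; 3; 5; 9]%N
    [:: 4; 6; 7; 8]%N 6%N 8%N.
  fused_equation E2 fP [:: 2; 3; 5; 9]%N [:: 2; 3; 5; 9]%N
    [:: 2; 3; 5; 9]%N 2%N 3%N.
  have kl : k = l by lra.
  apply: special_half => //.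
  by apply: (cancel (k + l)) => //; rewrite kl in E2 *; lra.
case/predU1P=> [-> fP|].
  fused_equation E1 fP [:: 2; 3; 6; 8]%N [:: 2; 3; 6; 8]%N
    [:: 2; 3; 6; 8]%N 6%N 8%N.
  fused_equation E2 fP [:: 2; 3; 6; 8]%N [:: 2; 3; 6; 8]%N
    [:: 2; 3; 6; 8]%N 2%N 3%N.
  have kl : k = l by lra.
  apply: special_half => //.
  by apply: (cancel (k + l)) => //; rewrite kl in E2 *; lra.
case/predU1P=> [-> fP|].
  fused_equation E1 fP [:: 3; 8]%N [:: 4; 9]%N [:: 5; 7]%N 5%N 7%N.
  fused_equation E2 fP [:: 2; 6]%N [:: 5; 7]%N [:: 4; 9]%N 4%N 9%N.
  fused_equation E3 fP [:: 2; 6]%N [:: 3; 8]%N [:: 4; 9]%N 4%N 9%N.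
  have e1 : l * x - l + 1 = 0 by apply: (cancel (l * x)) => //; lra.
  have e2 : k * x - 1 = 0 by apply: (cancel (k * (1 - x))) => //; lra.
  have e3 : k - l = - (k * x) * (k * x - 1) by lra.
  by rewrite e2 mulr0 in e3; apply: special_half; lra.
case/predU1P=> [-> fP|].
  fused_equation E1 fP [:: 2; 9]%N [:: 6; 7]%N [:: 3; 5]%N 3%N 5%N.
  fused_equation E2 fP [:: 3; 5]%N [:: 4; 8]%N [:: 2; 9]%N 2%N 9%N.
  fused_equation E3 fP [:: 2; 9]%N [:: 4; 8]%N [:: 6; 7]%N 6%N 7%N.
  have e1 : l * x - l + 1 = 0 by apply: (cancel (l * x)) => //; lra.
  have e2 : k * x - 1 = 0 by apply: (cancel (k * (1 - x))) => //; lra.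
  have e3 : k - l = l * x * (k * x - 1) by lra.
  by rewrite e2 mulr0 in e3; apply: special_half; lra.
case/predU1P=> [-> fP|].
  fused_equation E1 fP [:: 3; 5; 7]%N [:: 6; 8]%N [:: 2; 4; 9]%N 2%N 9%N.
  fused_equation E2 fP [:: 2; 4; 9]%N [:: 6; 8]%N [:: 3; 5; 7]%N 3%N 5%N.
  have e1 : l - 2 * (k * x) = 0 by apply: (cancel (k * (1 - x) + 1)); [lra|lra].
  have e2 : k - 2 * (l * (1 - x)) = 0 by apply: (cancel (l * x + 1)); [lra|lra].
  have : (2 * x - 1) ^+ 2 = 0.
    apply: (cancel k); first lra.
    have el : l = 2 * (k * x) by lra.
    by rewrite -[RHS]e2 el; ring.
  by move/eqP; rewrite sqrf_eq0 => /eqP e3; apply: SpecialC; nra.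
case/predU1P=> [-> fP|].
  fused_equation E1 fP [:: 2; 6; 7]%N [:: 5; 9]%N [:: 2; 6; 7]%N 2%N 7%N.
  fused_equation E2 fP [:: 2; 6; 7]%N [:: 3; 4; 8]%N [:: 2; 6; 7]%N 2%N 7%N.
  have e1 : 2 * x - 1 = 0 by apply: (cancel (k * l)); [exact: mulr_gt0|lra].
  by apply: SpecialC; nra.
case/predU1P=> [-> fP|].
  fused_equation E1 fP [:: 2; 6; 7]%N [:: 2; 6; 7]%N
    [:: 3; 4; 5; 8; 9]%N 3%N 4%N.
  fused_equation E2 fP [:: 2; 6; 7]%N [:: 2; 6; 7]%N [:: 2; 6; 7]%N 2%N 7%N.
  have [e1 e2] : x * (2 * k * l + k + l) = k * l - k + 2 * l /\
      x * (k ^+ 2 + k + l ^+ 2 + l) = l ^+ 2 + l by split; lra.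
  exact: special_two_ratios.
case/predU1P=> [-> fP|].
  fused_equation E1 fP [:: 2; 5; 6; 7; 9]%N [:: 2; 5; 6; 7; 9]%N
    [:: 2; 5; 6; 7; 9]%N 2%N 7%N.
  fused_equation E2 fP [:: 2; 5; 6; 7; 9]%N [:: 2; 5; 6; 7; 9]%N
    [:: 3; 4; 8]%N 3%N 4%N.
  have [e1 e2] : x * (2 * k * l + k + l) = k * l - k + 2 * l /\
      x * (k ^+ 2 + k + l ^+ 2 + l) = l ^+ 2 + l by split; lra.
  exact: special_two_ratios.
case/predU1P=> [-> fP|].
  fused_equation E1 fP [:: 2; 3; 4; 5; 7; 9]%N [:: 2; 3; 4; 5; 7; 9]%N
    [:: 2; 3; 4; 5; 7; 9]%N 2%N 3%N.
  fused_equation E2 fP [:: 2; 3; 4; 5; 7; 9]%N [:: 2; 3; 4; 5; 7; 9]%N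
    [:: 2; 3; 4; 5; 7; 9]%N 3%N 9%N.
  fused_equation E3 fP [:: 2; 3; 4; 5; 7; 9]%N [:: 2; 3; 4; 5; 7; 9]%N
    [:: 2; 3; 4; 5; 7; 9]%N 2%N 5%N.
  set N := k + l; set y := 1 - x.
  have e1 : k * (N + 2) = N ^+ 2 * y + N by rewrite /N /y; lra.
  have e2 : l * (N + 2) = N ^+ 2 * x + N by rewrite /N; lra.
  have e3 : 4 * k * x ^+ 2 = N * x - 2 * x + 1.
    by apply/eqP; rewrite -subr_eq0; apply/eqP/(cancel k) => //; rewrite /N; lra.
  have e4 : 4 * l * y ^+ 2 = N * y - 2 * y + 1.
    by apply/eqP; rewrite -subr_eq0; apply/eqP/(cancel l) => //; rewrite /N /y; lra.
  have N2 : 2 < N by rewrite /N; lra.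
  (* [f3] and [f4] eliminate k and l; their sum, with x + y = 1, is the claim. *)
  have e5 : (N * (N - 2)) * (4 * x * y - 1) = 0.
    have f3 : 4 * (N ^+ 2 * y + N) * x ^+ 2 = (N + 2) * (N * x - 2 * x + 1).
      by rewrite -e1 -e3; ring.
    have f4 : 4 * (N ^+ 2 * x + N) * y ^+ 2 = (N + 2) * (N * y - 2 * y + 1).
      by rewrite -e2 -e4; ring.
    have xy : x = 1 - y by rewrite /y; ring.
    by rewrite xy in f3 f4 *; lra.
  have : (2 * x - 1) ^+ 2 = 0.
    have NN : 0 < N * (N - 2) by apply: mulr_gt0; lra.
    by have := cancel _ _ NN e5; rewrite /y => e6; lra.
  move/eqP; rewrite sqrf_eq0 => /eqP e6; have xh : x = 2^-1 by lra.
  apply: SpecialC => //; have : (N + 2) * (k - l) = 0 by rewrite /y xh in e1 e2; lra.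
  by move/(cancel (N + 2)); lra.
case/predU1P=> [-> fP|].
  fused_equation E1 fP [:: 2; 3; 4; 6; 7; 8]%N [:: 2; 3; 4; 6; 7; 8]%N
    [:: 2; 3; 4; 6; 7; 8]%N 2%N 6%N.
  fused_equation E2 fP [:: 2; 3; 4; 6; 7; 8]%N [:: 2; 3; 4; 6; 7; 8]%N
    [:: 2; 3; 4; 6; 7; 8]%N 3%N 6%N.
  have e1 : k ^+ 2 + 4 * k * l * x - 3 * k * l - k + l = 0.
    by apply: (cancel x) => //; lra.
  have e2 : - (4 * k * l * x) + k * l + k + l ^+ 2 - l = 0.
    by apply: (cancel (1 - x)) => //; lra.
  (* This is the sum of [e1] and [e2]. *)
  have : (k - l) ^+ 2 = 0 by lra.
  move/eqP; rewrite sqrf_eq0 => /eqP e3; have kl : k = l by lra.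
  by apply: special_half => //; apply: (cancel (2 * k)); rewrite ?kl in e1 *; lra.
case/predU1P=> [-> fP|].
  fused_equation E1 fP [:: 2; 3]%N [:: 4; 5; 9]%N [:: 4; 5; 9]%N 4%N 9%N.
  fused_equation E2 fP [:: 4; 5; 9]%N [:: 4; 5; 9]%N [:: 6; 7; 8]%N 6%N 8%N.
  (* [E1] says k = l - 1. In this partition and the next three, the first equation makes k and l
     differ by 1 while the second makes them equal. *)
  have : k - l = 0 by apply: (cancel (1 - x)) => //; lra.
  by move=> e; exfalso; lra.
case/predU1P=> [-> fP|].
  fused_equation E1 fP [:: 2; 3]%N [:: 4; 6; 8]%N [:: 4; 6; 8]%N 4%N 8%N.
  fused_equation E2 fP [:: 5; 7; 9]%N [:: 5; 7; 9]%N [:: 4; 6; 8]%N 6%N 8%N.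
  have : k - l = 0 by apply: (cancel x) => //; lra.
  by move=> e; exfalso; lra.
case/predU1P=> [-> fP|].
  fused_equation E1 fP [:: 2; 5; 9]%N [:: 4; 7]%N [:: 2; 5; 9]%N 2%N 9%N.
  fused_equation E2 fP [:: 2; 5; 9]%N [:: 2; 5; 9]%N [:: 3; 6; 8]%N 6%N 8%N.
  have : k - l = 0 by apply: (cancel (1 - x)) => //; lra.
  by move=> e; exfalso; lra.
case/predU1P=> [-> fP|].
  fused_equation E1 fP [:: 2; 6; 8]%N [:: 4; 7]%N [:: 2; 6; 8]%N 2%N 6%N.
  fused_equation E2 fP [:: 3; 5; 9]%N [:: 3; 5; 9]%N [:: 2; 6; 8]%N 6%N 8%N.
  have : k - l = 0 by apply: (cancel x) => //; lra.
  by move=> e; exfalso; lra.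
case/predU1P=> [-> fP|].
  fused_equation E1 fP [:: 2; 5; 7; 9]%N [:: 2; 5; 7; 9]%N
    [:: 2; 5; 7; 9]%N 7%N 9%N.
  fused_equation E2 fP [:: 2; 5; 7; 9]%N [:: 2; 5; 7; 9]%N
    [:: 3; 4; 6; 8]%N 4%N 6%N.
  fused_equation E3 fP [:: 2; 5; 7; 9]%N [:: 2; 5; 7; 9]%N
    [:: 2; 5; 7; 9]%N 2%N 7%N.
  have e1 : 4 * (k * x) - k - l + 3 = 0 by apply: (cancel (k * x)) => //; lra.
  have e2 : k + 4 * (l * x) - 3 * l + 1 = 0 by apply: (cancel (k * x)) => //; lra.
  have e3 : k * x + l * x - l = 0 by apply: (cancel (k + l + 1)) => //; lra.
  (* [e1] plus [e2] minus four times [e3] reads 4 = 0. *)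
  by exfalso; lra.
case/predU1P=> [-> fP|].
  fused_equation E1 fP [:: 2; 6; 7; 8]%N [:: 2; 6; 7; 8]%N
    [:: 3; 4; 5; 9]%N 3%N 9%N.
  fused_equation E2 fP [:: 2; 6; 7; 8]%N [:: 2; 6; 7; 8]%N
    [:: 2; 6; 7; 8]%N 2%N 8%N.
  fused_equation E3 fP [:: 2; 6; 7; 8]%N [:: 2; 6; 7; 8]%N
    [:: 2; 6; 7; 8]%N 2%N 7%N.
  have e1 : 4 * (k * x) - k - l + 3 = 0 by apply: (cancel (k * x)) => //; lra.
  have e2 : k + 4 * (l * x) - 3 * l + 1 = 0 by apply: (cancel (k * x)) => //; lra.
  have e3 : k * x + l * x - l = 0 by apply: (cancel (k + l + 1)) => //; lra.
  by exfalso; lra.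
case/predU1P=> [-> fP|].
  fused_equation E1 fP [:: 2; 4]%N [:: 2; 4]%N [:: 3; 5; 7]%N 3%N 5%N.
  fused_equation E2 fP [:: 2; 4]%N [:: 6; 8]%N [:: 3; 5; 7]%N 3%N 5%N.
  have y1 : 1 - x != 0 by rewrite gt_eqF.
  have e1 : k = 2 / (1 - x) by apply: (canRL (mulfK y1)); lra.
  have e2 : l = k / 2 / (1 - x) by apply: (canRL (mulfK y1)); lra.
  (* In case E, l = m^2 and l (1 - x) = m, which forces this m. In case D below, k = m^2 and k x = m
     force m = 1 / x. *)
  apply: (SpecialE (m := (1 - x)^-1)); rewrite ?e2 e1; field => //.
case/predU1P=> [-> fP|].
  fused_equation E1 fP [:: 3; 7]%N [:: 3; 7]%N [:: 2; 4; 9]%N 2%N 9%N.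
  fused_equation E2 fP [:: 3; 7]%N [:: 6; 8]%N [:: 2; 4; 9]%N 2%N 9%N.
  have xn0 : x != 0 by rewrite gt_eqF.
  have e1 : l = 2 / x by apply: (canRL (mulfK xn0)); lra.
  have e2 : k = l / 2 / x by apply: (canRL (mulfK xn0)); lra.
  apply: (SpecialD (m := x^-1)); rewrite ?e2 e1; field => //.
case/predU1P=> [-> fP|].
  fused_equation E1 fP [:: 2; 4; 9]%N [:: 2; 4; 9]%N
    [:: 3; 5; 6; 7; 8]%N 3%N 5%N.
  fused_equation E2 fP [:: 2; 4; 9]%N [:: 2; 4; 9]%N
    [:: 3; 5; 6; 7; 8]%N 3%N 6%N.
  fused_equation E3 fP [:: 2; 4; 9]%N [:: 2; 4; 9]%N [:: 2; 4; 9]%N 2%N 9%N.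
  have e2 : k * (1 - l * x) = l * (3 - l).
    by apply/eqP; rewrite -subr_eq0; apply/eqP/(cancel (1 - x)) => //; lra.
  have [f1 f2] : l * x = 2 /\ k = l * (l - 3) by apply: cubic_system => //; lra.
  have f3 : k * x = 2 * (l - 3) by rewrite f2 -f1; ring.
  by apply: SpecialG => //; lra.
case/predU1P=> [-> fP|].
  fused_equation E1 fP [:: 2; 4; 6; 8; 9]%N [:: 2; 4; 6; 8; 9]%N
    [:: 3; 5; 7]%N 3%N 5%N.
  fused_equation E2 fP [:: 2; 4; 6; 8; 9]%N [:: 2; 4; 6; 8; 9]%N
    [:: 2; 4; 6; 8; 9]%N 2%N 6%N.
  fused_equation E3 fP [:: 2; 4; 6; 8; 9]%N [:: 2; 4; 6; 8; 9]%N
    [:: 2; 4; 6; 8; 9]%N 2%N 9%N.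
  have e2 : l * (1 - k * (1 - x)) = k * (3 - k).
    by apply/eqP; rewrite -subr_eq0; apply/eqP/(cancel x) => //; lra.
  (* Exchanging A_1 and A_2 replaces (k, l, x) by (l, k, 1 - x) and turns this partition into the
     preceding one. *)
  have [f1 f2] : k * (1 - x) = 2 /\ l = k * (k - 3).
    by apply: cubic_system => //; lra.
  have f3 : l * (1 - x) = 2 * (k - 3) by rewrite f2 -f1; ring.
  by apply: SpecialH => //; lra.
case/predU1P=> [-> fP|].
  fused_equation E1 fP [:: 2; 4; 5; 9]%N [:: 2; 4; 5; 9]%N
    [:: 2; 4; 5; 9]%N 2%N 5%N.
  fused_equation E2 fP [:: 2; 4; 5; 9]%N [:: 2; 4; 5; 9]%N
    [:: 3; 6; 7; 8]%N 3%N 6%N.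
  have e1 : 4 * (l * x) = 3 * l - k - 1.
    by apply/eqP; rewrite -subr_eq0; apply/eqP/(cancel (l * (1 - x))) => //; lra.
  have e2 : 4 * (k * x) = k + l - 3.
    by apply/eqP; rewrite -subr_eq0; apply/eqP/(cancel (l * (1 - x))) => //; lra.
  have e3 : (k - l) ^+ 2 + k - 3 * l = 0.
    (* Substituting [e1] and [e2] into the two forms of 4 k l x eliminates x. *)
    have : k * (4 * (l * x)) = l * (4 * (k * x)) by ring.
    by rewrite e1 e2 => ?; lra.
  (* In case J, k - l = 2 q + 1, which determines q; the same holds in case I below. *)
  by apply: (SpecialJ (q := (k - l - 1) / 2)); lra.
case/predU1P=> [-> fP|//].
fused_equation E1 fP [:: 2; 4; 6; 8]%N [:: 2; 4; 6; 8]%N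
  [:: 3; 5; 7; 9]%N 3%N 9%N.
fused_equation E2 fP [:: 2; 4; 6; 8]%N [:: 2; 4; 6; 8]%N
  [:: 2; 4; 6; 8]%N 2%N 6%N.
have e1 : 4 * (k * x) = k + l + 1.
  by apply/eqP; rewrite -subr_eq0; apply/eqP/(cancel (k * x)) => //; lra.
have e2 : 4 * (l * x) = 3 * l + 3 - k.
  by apply/eqP; rewrite -subr_eq0; apply/eqP/(cancel (k * x)) => //; lra.
have e3 : (k - l) ^+ 2 + l - 3 * k = 0.
  have : k * (4 * (l * x)) = l * (4 * (k * x)) by ring.
  by rewrite e1 e2 => ?; lra.
by apply: (SpecialI (q := (k - l - 1) / 2)); lra.
Qed.

End SpecialPartitions.

(** * Parameters of the algebra *)

Local Notation o0 := (ord0 : 'I_3).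
Definition o1 : 'I_3 := @Ordinal 3 1 isT.
Definition o2 : 'I_3 := @Ordinal 3 2 isT.

Lemma ord3P (P : 'I_3 -> Prop) : P o0 -> P o1 -> P o2 -> forall i, P i.
Proof.
by move=> P0 P1 P2 [[|[|[|//]]] p]; [move: P0|move: P1|move: P2];
  congr P; apply: val_inj.
Qed.

Lemma sum3 (V : nmodType) (F : 'I_3 -> V) : \sum_i F i = F o0 + F o1 + F o2.
Proof.
rewrite !big_ord_recl big_ord0 addr0 addrA.
by congr (F _ + F _ + F _); apply: val_inj.
Qed.

Section Sita3.
Variables (R : realType) (A : sita3 R).
Local Notation b i := (tnth (std A) i).
Local Notation c := (structure_constant (std A)).

Lemma stdE (v : A) : v = \sum_i coord (std A) i v *: b i.
Proof.
rewrite {1}(coord_basis (std_basis A) (memvf v)).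
by apply: eq_bigr => i _; rewrite (tnth_nth 0).
Qed.

Lemma std_mulE i j : b i * b j = \sum_h c i j h *: b h.
Proof. exact: stdE. Qed.

Lemma structure_constantC i j h : c i j h = c j i h.
Proof. by rewrite /structure_constant alg_mulC. Qed.

Lemma coord_std i j : coord (std A) j (b i) = (i == j)%:R.
Proof. by rewrite (tnth_nth 0) coord_free // (basis_free (std_basis A)). Qed.

Lemma structure_constant0 j h : c ord0 j h = (j == h)%:R.
Proof. by rewrite /structure_constant std0 mul1r coord_std. Qed.

(* Both sides are the coefficient of 1 in A_i A_j A_m. *)
Lemma structure_constant_cycle i j m :
  c i j m * valency A (b m) = c j m i * valency A (b i).
Proof.
have coord0 u v : coord (std A) ord0 (b u * b v) =
    (u == v)%:R * valency A (b v).
  have [->|uv] := eqVneq u v; first by rewrite mul1r -structure_constant_eq.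
  by rewrite mul0r; apply: structure_constant_neq.
have: coord (std A) ord0 (b i * b j * b m) = coord (std A) ord0 (b i * (b j * b m)).
  by rewrite mulrA.
rewrite std_mulE mulr_suml linear_sum (bigD1 m) //= big1 => [|h hm]; last first.
  by rewrite -scalerAl linearZ /= coord0 (negPf hm) mul0r mulr0.
rewrite -scalerAl linearZ /= coord0 eqxx mul1r addr0 => ->.
rewrite std_mulE mulr_sumr linear_sum (bigD1 i) //= big1 => [|h hm]; last first.
  by rewrite -scalerAr linearZ /= coord0 eq_sym (negPf hm) mul0r mulr0.
by rewrite -scalerAr linearZ /= coord0 eqxx mul1r addr0.
Qed.

Lemma valency_mul i j :
  valency A (b i) * valency A (b j) = \sum_h c i j h * valency A (b h) :> Cx R.
Proof.
transitivity (valency A (b i * b j) : Cx R); first by rewrite rmorphM.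
by rewrite std_mulE linear_sum; apply: eq_bigr => h _; rewrite linearZ.
Qed.

(** Being nonnegative in the order of [Cx R], the structure constants are real, and the ordered
    field [R] can take over. *)
Definition rsc i j h : R := complex.Re (c i j h).

Lemma rscE i j h : c i j h = real_complex R (rsc i j h).
Proof. by rewrite /rsc RRe_real // ger0_real // structure_constant_ge0. Qed.

Lemma rsc_ge0 i j h : 0 <= rsc i j h.
Proof. by have := structure_constant_ge0 A i j h; rewrite lecE => /andP[]. Qed.

Lemma rsc_valency i : valency A (b i) = real_complex R (rsc i i ord0).
Proof. by rewrite -structure_constant_eq rscE. Qed.

Lemma rsc_valency_gt0 i : 0 < rsc i i ord0.
Proof.
rewrite lt_def rsc_ge0 andbT; apply/eqP => e.
have [d d0] := valency_nat A i; rewrite rsc_valency e => /esym/eqP.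
by rewrite pnatr_eq0; case: d d0.
Qed.

Lemma rsc_cycle i j m :
  rsc i j m * rsc m m ord0 = rsc j m i * rsc i i ord0.
Proof.
apply: (@complexI R); rewrite !rmorphM /= -!rscE !structure_constant_eq.
exact: structure_constant_cycle.
Qed.

Lemma rsc_valency_mul i j :
  rsc i i ord0 * rsc j j ord0 = \sum_h rsc i j h * rsc h h ord0.
Proof.
apply: (@complexI R); rewrite rmorphM rmorph_sum /= -!rsc_valency valency_mul.
by apply: eq_bigr => h _; rewrite rmorphM /= -rscE -rsc_valency.
Qed.

Lemma rscC i j h : rsc i j h = rsc j i h.
Proof. by rewrite /rsc structure_constantC. Qed.

Lemma rsc0 j h : rsc ord0 j h = (j == h)%:R.
Proof. by rewrite /rsc structure_constant0; case: eqP. Qed.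

Lemma rsc_neq i j : i != j -> rsc i j ord0 = 0.
Proof. by move=> ij; rewrite /rsc structure_constant_neq. Qed.

Definition kA := rsc o1 o1 ord0.
Definition lA := rsc o2 o2 ord0.
Definition xA := rsc o1 o2 o2 / kA.

Lemma rsc_sconst i j h :
  rsc i j h = sconstR 1 kA lA (kA * xA) (lA * (1 - xA)) i j h.
Proof.
have k0 : kA != 0 by rewrite gt_eqF // rsc_valency_gt0.
have l0 : lA != 0 by rewrite gt_eqF // rsc_valency_gt0.
have ea : kA * xA = rsc o1 o2 o2 by rewrite /xA mulrC divfK.
have v11 := rsc_valency_mul o1 o1; have v12 := rsc_valency_mul o1 o2.
have v22 := rsc_valency_mul o2 o2.
have c112 := rsc_cycle o1 o1 o2; have c122 := rsc_cycle o1 o2 o2.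
rewrite !sum3 !rsc0 /= ?(rsc_neq (isT : o1 != o2)) in v11 v12 v22.
rewrite -/kA -/lA in c112 c122 v11 v12 v22.
(* [v12] reads k l = b k + a l, and a = k x. *)
have eb : rsc o1 o2 o1 = lA * (1 - xA).
  by apply: (mulIf k0); rewrite mulrBr mulrBl mulr1 -mulrA [xA * _]mulrC ea; lra.
have e112 : rsc o1 o1 o2 = kA - kA * xA.
  by apply: (mulIf l0); rewrite c112 eb; ring.
have e221 : rsc o2 o2 o1 = lA - lA * (1 - xA).
  by apply: (mulIf k0); rewrite -c122 -ea; ring.
have e111 : rsc o1 o1 o1 = kA - 1 - lA * (1 - xA).
  by apply: (mulIf k0); rewrite e112 in v11; lra.
have e222 : rsc o2 o2 o2 = lA - 1 - kA * xA.
  by apply: (mulIf l0); rewrite e221 in v22; lra.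
have r0 j' h' : rsc j' ord0 h' = (j' == h')%:R by rewrite rscC rsc0.
elim/ord3P: i; elim/ord3P: j; elim/ord3P: h => /=;
  rewrite ?rsc0 ?r0 ?[rsc o2 o1 _]rscC ?e111 ?e112 ?e221 ?e222 ?eb -?ea //.
all: by rewrite ?(rsc_neq (isT : o1 != o2)).
Qed.

Lemma xA_bounds : 0 <= xA <= 1.
Proof.
rewrite divr_ge0 ?rsc_ge0 //=.
have := rsc_ge0 o1 o2 o1; rewrite rsc_sconst /= pmulr_rge0 ?subr_ge0 //.
exact: rsc_valency_gt0.
Qed.

Lemma lam_ge0 : 0 <= kA - 1 - lA * (1 - xA).
Proof. by have := rsc_ge0 o1 o1 o1; rewrite rsc_sconst. Qed.

Lemma mu_ge0 : 0 <= lA - 1 - kA * xA.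
Proof. by have := rsc_ge0 o2 o2 o2; rewrite rsc_sconst. Qed.

Lemma kA_gt0 : 0 < kA. Proof. exact: rsc_valency_gt0. Qed.
Lemma lA_gt0 : 0 < lA. Proof. exact: rsc_valency_gt0. Qed.

End Sita3.

(** * Fusions of the tensor square *)

Section TensorFusion.
Variables (R : realType) (A : sita3 R).
Local Notation b i := (tnth (std A) i).

Definition tindex (t : 'I_10) : 'I_3 * 'I_3 :=
  (inord (t.-1 %% 3), inord (t.-1 %/ 3)).

Definition tlabel (p : 'I_3 * 'I_3) : 'I_10 := inord (p.2 * 3 + p.1).+1.

Lemma tindex1 (t : 'I_10) : (tindex t).1 = (t.-1 %% 3)%N :> nat.
Proof. by rewrite inordK // ltn_pmod. Qed.

Lemma tindex2 (t : 'I_10) : (tindex t).2 = (t.-1 %/ 3)%N :> nat.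
Proof. by rewrite inordK // ltn_divLR //; case: t => [[|t] ?]. Qed.

Lemma tlabelK : cancel tlabel tindex.
Proof.
move=> [i j]; have lt : ((j * 3 + i).+1 < 10)%N.
  by elim/ord3P: i; elim/ord3P: j.
have e : (tlabel (i, j)).-1 = (j * 3 + i)%N by rewrite inordK.
congr pair; apply: val_inj.
  by rewrite -[LHS]/(nat_of_ord (tindex (tlabel (i, j))).1) tindex1 e modnMDl modn_small.
rewrite -[LHS]/(nat_of_ord (tindex (tlabel (i, j))).2) tindex2 e.
by rewrite divnMDl // divn_small // addn0.
Qed.

(** Label 0 shares its indices with label 1 and must be excluded. *)
Lemma tindexK (t : 'I_10) : (0 < t)%N -> tlabel (tindex t) = t.
Proof.
move=> t0; apply: val_inj; rewrite /tlabel tindex1 tindex2 -divn_eq prednK //.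
by rewrite inord_val.
Qed.

Lemma tcoord_C t u : tcoord (C_ A t) (tindex u) = (tindex u == tindex t)%:R.
Proof. exact: tcoord_std. Qed.

Lemma tcoord0 p : tcoord (0 : tensor2 A) p = 0.
Proof. by rewrite /tcoord linear0 mxE. Qed.

Lemma tcoord_sum (I : Type) (r : seq I) (P : pred I) (F : I -> tensor2 A) p :
  tcoord (\sum_(i <- r | P i) F i) p = \sum_(i <- r | P i) tcoord (F i) p.
Proof.
elim/big_rec2: _ => [|i y X _ <-]; first exact: tcoord0.
by rewrite -[F i]scale1r tcoordP mul1r scale1r.
Qed.

Lemma tensor_sumE (X : tensor2 A) :
  X = \sum_(t : 'I_10 | (0 < t)%N) tcoord X (tindex t) *: C_ A t.
Proof.
have -> : \sum_(t : 'I_10 | (0 < t)%N) tcoord X (tindex t) *: C_ A t =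
    \sum_p tcoord X p *: tens (b p.1) (b p.2).
  rewrite [RHS](reindex_onto tindex tlabel) => [|p _]; last exact: tlabelK.
  apply: eq_big => // t; apply/idP/eqP => [/tindexK//|<-].
  by rewrite /tlabel inordK //; elim/ord3P: (tindex t).1; elim/ord3P: (tindex t).2.
rewrite -{1}[X]vec_mxK [vec_mx X]matrix_sum_delta pair_big linear_sum.
by apply: eq_bigr => p _; rewrite linearZ /= tens_std.
Qed.

Lemma tcoord_CM s t u :
  tcoord (C_ A s * C_ A t) (tindex u) =
  real_complex R (tconstR 1 (kA A) (lA A) (kA A * xA A) (lA A * (1 - xA A)) s t u).
Proof.
rewrite tmulE /C_ -/(tindex s).1 -/(tindex s).2 -/(tindex t).1 -/(tindex t).2.
rewrite tensM /tcoord mxvecK mxE -!/(structure_constant _ _ _ _) !rscE -rmorphM.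
by rewrite !rsc_sconst /tconstR /tconst -!tindex1 -!tindex2 !inord_val.
Qed.

(** The increasing list of labels is the canonical form in which blocks are compared with the lists
    of the search. *)
Definition block_seq (T : {set 'I_10}) : seq nat :=
  [seq t <- iota 2 8 | (inord t : 'I_10) \in T].

Lemma C_sum_seq (T : {set 'I_10}) : T \subset labels ->
  C_sum A T = \sum_(t <- block_seq T) C_ A (inord t).
Proof.
move=> /subsetP sT; rewrite big_filter /C_sum.
rewrite (eq_bigr (fun t : 'I_10 => C_ A (inord t))) => [|t _];
  last by rewrite inord_val.
rewrite (eq_bigl (fun t : 'I_10 => (inord t : 'I_10) \in T)) => [|t];
  last by rewrite inord_val.
rewrite -(big_mkord (fun t => (inord t : 'I_10) \in T) (fun t => C_ A (inord t))).
rewrite big_ltn_cond // ifF; last by apply/negP => /sT; rewrite inE inordK.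
rewrite big_ltn_cond // ifF //; by apply/negP => /sT; rewrite inE inordK.
Qed.

Lemma tcoord_C_sumM (S T : {set 'I_10}) (u : 'I_10) :
  S \subset labels -> T \subset labels ->
  tcoord (C_sum A S * C_sum A T) (tindex u) =
  real_complex R (tcoef (kA A) (lA A) (xA A) (block_seq S) (block_seq T) u).
Proof.
move=> sS sT; rewrite !C_sum_seq // mulr_suml tcoord_sum rmorph_sum /=.
have lt10 (U : {set 'I_10}) t : t \in block_seq U -> (t < 10)%N.
  by rewrite mem_filter mem_iota => /and3P[].
rewrite !big_seq; apply: eq_bigr => s /lt10 s10.
rewrite mulr_sumr tcoord_sum rmorph_sum /= !big_seq.
by apply: eq_bigr => t /lt10 t10; rewrite tcoord_CM !inordK.
Qed.

Lemma tcoordZ a (X : tensor2 A) p : tcoord (a *: X) p = a * tcoord X p.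
Proof. by rewrite -[a *: X]addr0 tcoordP tcoord0 addr0. Qed.

Lemma C1E : C_ A (inord 1) = 1.
Proof.
have e : inord 0 = ord0 :> 'I_3 by apply: val_inj; rewrite /= inordK.
by rewrite /C_ inordK // mod0n div0n e std0.
Qed.

Lemma tcoord1 (t : 'I_10) : t \in labels -> tcoord (1 : tensor2 A) (tindex t) = 0.
Proof.
rewrite inE => t2; rewrite -C1E tcoord_C; case: eqP => // /(congr1 tlabel).
rewrite !tindexK ?inordK // ?(ltn_trans _ t2) // => e.
by move: t2; rewrite e inordK.
Qed.

Section Partition.
Variable tau : {set {set 'I_10}}.
Hypothesis tauP : partition tau labels.

Lemma block_labels T : T \in tau -> T \subset labels.
Proof.
move=> Ttau; have /and3P[/eqP <- _ _] := tauP.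
by apply/subsetP => t tT; apply/bigcupP; exists T.
Qed.

Lemma block_uniq T U t : T \in tau -> U \in tau -> t \in T -> t \in U -> T = U.
Proof.
have /and3P[_ triv _] := tauP => Ttau Utau tT tU.
by rewrite -(def_pblock triv Ttau tT) (def_pblock triv Utau tU).
Qed.

Lemma tcoord_C_sum T (t : 'I_10) : t \in labels -> T \in tau ->
  tcoord (C_sum A T) (tindex t) = (t \in T)%:R.
Proof.
rewrite inE => t2 Ttau; have t0 : (0 < t)%N by apply: leq_trans t2.
rewrite tcoord_sum; have [tT|tT] := boolP (t \in T).
  rewrite (bigD1 t) //= tcoord_C eqxx big1 ?addr0 // => u /andP[uT ut].
  rewrite tcoord_C; case: eqP => // /(congr1 tlabel).
  have := subsetP (block_labels Ttau) u uT; rewrite inE => u2.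
  by rewrite !tindexK // ?(leq_trans _ u2) // => tu; rewrite tu eqxx in ut.
rewrite big1 // => u uT; rewrite tcoord_C; case: eqP => // /(congr1 tlabel).
have := subsetP (block_labels Ttau) u uT; rewrite inE => u2.
by rewrite !tindexK // ?(leq_trans _ u2) // => tu; rewrite tu uT in tT.
Qed.

(** The generator C_1 absorbs the coordinate at label 1. The rest of X splits over the blocks, and a
    coordinate constant on T factors out as a multiple of C_T. *)
Lemma fusion_spanP (X : tensor2 A) :
  X \in fusion_span A tau <->
  (forall U, U \in tau ->
     {in U &, forall a c, tcoord X (tindex a) = tcoord X (tindex c)}).
Proof.
split=> [Xspan U Utau a c aU cU|Xconst].
  have sU := subsetP (block_labels Utau).
  have gen Y : Y \in C_ A (inord 1) :: [seq C_sum A T | T <- enum tau] ->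
      tcoord Y (tindex a) = tcoord Y (tindex c).
    rewrite inE => /predU1P[->|/mapP[T]]; first by rewrite C1E !tcoord1 ?sU.
    rewrite mem_enum => Ttau ->; rewrite !tcoord_C_sum ?sU //; congr (_%:R).
    by congr nat_of_bool; apply/idP/idP => h; rewrite (block_uniq Ttau Utau h).
  rewrite (coord_span (X := in_tuple _) Xspan) !tcoord_sum.
  apply: eq_bigr => i _; rewrite !tcoordZ; congr (_ * _); apply: gen.
  exact: mem_nth.
have genP Y : Y \in C_ A (inord 1) :: [seq C_sum A T | T <- enum tau] ->
  Y \in fusion_span A tau by exact: memv_span.
rewrite (tensor_sumE X) (bigD1 (inord 1)) /= ?inordK //.
apply: memvD; first by rewrite memvZ // genP // mem_head.
rewrite (eq_bigl (mem labels)) => [|t]; last first.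
  by rewrite /= inE -val_eqE /= inordK //; case: (nat_of_ord t) => [|[]].
have /and3P[/eqP <- triv nz] := tauP; rewrite big_trivIset //=.
apply: memv_suml => T Ttau.
have [t tT] : exists t, t \in T.
  by apply/set0Pn; apply: contraNneq nz => <-.
have -> : \sum_(u in T) tcoord X (tindex u) *: C_ A u =
    tcoord X (tindex t) *: C_sum A T.
  by rewrite scaler_sumr; apply: eq_bigr => u uT; rewrite (Xconst T Ttau u t).
by rewrite memvZ // genP // inE map_f ?orbT // mem_enum.
Qed.

Definition is_block (B : seq nat) : Prop := exists2 T, T \in tau & B = block_seq T.

(** Since C_1 is the identity, closure only concerns products of two block sums, to which
    [fusion_spanP] applies. *)
Lemma gives_fusionP :
  gives_fusion A tau <-> fused (kA A) (lA A) (xA A) is_block.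
Proof.
have mem_block T t : T \in tau -> (t \in block_seq T) ->
    (inord t : 'I_10) \in T /\ (t < 10)%N.
  by move=> Ttau; rewrite mem_filter mem_iota => /and3P[].
have block_mem T (t : 'I_10) : T \in tau -> t \in T -> (t : nat) \in block_seq T.
  move=> Ttau tT; rewrite mem_filter inord_val tT mem_iota ltn_ord andbT /=.
  by have := subsetP (block_labels Ttau) t tT; rewrite inE.
have sumP T : T \in tau -> C_sum A T \in fusion_span A tau.
  by move=> Ttau; apply: memv_span; rewrite inE map_f ?orbT // mem_enum.
split=> [/subvP fus _ _ _ a c [S Stau ->] [T Ttau ->] [U Utau ->]|fus].
  move=> /(mem_block _ _ Utau)[aU a10] /(mem_block _ _ Utau)[cU c10].
  have := fus _ (memv_mul (sumP S Stau) (sumP T Ttau)).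
  move/fusion_spanP/(_ U Utau _ _ aU cU).
  by rewrite !tcoord_C_sumM ?block_labels // !inordK // => /complexI.
have gen Y Z : Y \in C_ A (inord 1) :: [seq C_sum A T | T <- enum tau] ->
    Z \in C_ A (inord 1) :: [seq C_sum A T | T <- enum tau] ->
    Y * Z \in fusion_span A tau.
  move=> Yg Zg; move: (Yg) (Zg); rewrite !inE C1E.
  case/predU1P=> [->|]; first by rewrite mul1r => _; exact: memv_span.
  move=> /mapP[S]; rewrite mem_enum => Stau YS.
  case/predU1P=> [->|]; first by rewrite mulr1; exact: memv_span.
  move=> /mapP[T]; rewrite mem_enum => Ttau ->; rewrite YS.
  apply/fusion_spanP => U Utau a c aU cU; rewrite !tcoord_C_sumM ?block_labels //.
  congr (real_complex R _).
  apply: (fus _ _ (block_seq U)); do ?[by exists S|by exists T|by exists U].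
    exact: block_mem.
  exact: block_mem.
apply/prodvP => X Y Xs Ys.
rewrite (coord_span (X := in_tuple _) Xs) (coord_span (X := in_tuple _) Ys).
rewrite mulr_suml; apply: memv_suml => i _; rewrite mulr_sumr; apply: memv_suml => j _.
by rewrite -scalerAl -scalerAr !memvZ // gen // mem_nth.
Qed.

End Partition.
End TensorFusion.

(** * Passage between set partitions and lists of blocks *)

Section OfBlocks.
Variables (tau : {set {set 'I_10}}) (tauP : partition tau labels).

Lemma block_seqK (T : {set 'I_10}) :
  T \subset labels -> [set:: [seq inord t | t <- block_seq T]] = T.
Proof.
move=> /subsetP sT; apply/setP => t; rewrite inE; apply/mapP/idP => [[u]|tT].
  by rewrite mem_filter => /andP[uT _] ->.
exists (t : nat); last by rewrite inord_val.
rewrite mem_filter inord_val tT mem_iota ltn_ord andbT /=.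
by have := sT t tT; rewrite inE.
Qed.

(** A block is nonempty, so one of its labels is covered by a block listed in [P]; by disjointness
    the two coincide. *)
Lemma of_blocks_partition P :
  (forall S, S \in P -> is_block tau S) ->
  (forall t, t \in iota 2 8 -> has (fun S => t \in S) P) -> tau = of_blocks P.
Proof.
move=> Pblk Pcov; apply/setP => T; rewrite inE; apply/idP/mapP => [Ttau|[S SP ->]].
  have [t tT] : exists t, t \in T.
    by apply/set0Pn; have /and3P[_ _] := tauP; apply: contraNneq => <-.
  have t2 := subsetP (block_labels tauP Ttau) t tT; rewrite inE in t2.
  have [|S SP tS] := hasP (Pcov t _); first by rewrite mem_iota t2 ltn_ord.
  exists S => //; have [T' T'tau ST'] := Pblk S SP.
  rewrite ST' block_seqK ?(block_labels tauP) //.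
  apply: (block_uniq tauP Ttau T'tau tT).
  by move: tS; rewrite ST' mem_filter inord_val => /andP[].
by have [U Utau ->] := Pblk S SP; rewrite block_seqK ?(block_labels tauP).
Qed.

Lemma of_blocks_perm P Q : perm_eq P Q -> of_blocks P = of_blocks Q.
Proof. by move=> PQ; apply/setP => T; rewrite !inE; apply/perm_mem/perm_map. Qed.

Lemma is_block_subseqs B : is_block tau B -> B \in subseqs (iota 2 8).
Proof.
move=> [T _ ->]; rewrite /block_seq; elim: (iota 2 8) => //= t s IHs.
by rewrite mem_cat; case: ifP => _; rewrite ?IHs // map_f ?orbT.
Qed.

Lemma is_block_cover m : m \in iota 2 8 -> exists2 B, is_block tau B & m \in B.
Proof.
rewrite mem_iota => m28; have /and3P[/eqP cov _ _] := tauP.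
have : (inord m : 'I_10) \in labels by rewrite inE inordK; case/andP: m28.
rewrite -cov => /bigcupP[T Ttau mT]; exists (block_seq T); first by exists T.
by rewrite mem_filter mT mem_iota.
Qed.

Lemma is_block_disj B B' t :
  is_block tau B -> is_block tau B' -> t \in B -> t \in B' -> B = B'.
Proof.
move=> [T Ttau ->] [T' T'tau ->]; rewrite !mem_filter => /andP[tT _] /andP[tT' _].
by rewrite (block_uniq tauP Ttau T'tau tT tT').
Qed.

End OfBlocks.

Lemma is_block_of_blocks P B :
  P \in generic_blocks -> is_block (of_blocks P) B -> B \in P.
Proof.
(* Every listed block is increasing with entries from 2 to 9, so it is recovered exactly from its
   set. *)
have : all (all (fun S => [seq t <- iota 2 8 | t \in S] == S)) generic_blocks by [].
move=> /allP gen /gen /allP Pfix [T]; rewrite inE => /mapP[S SP ->] ->.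
suff -> : block_seq [set:: [seq inord t | t <- S]] = S by [].
have /eqP fixS := Pfix S SP; rewrite -[RHS]fixS; apply: eq_in_filter => t.
rewrite mem_iota inE => /andP[_ t10]; apply/mapP/idP => [[u uS]|tS]; last by exists t.
have u10 : (u < 10)%N by move: uS; rewrite -fixS mem_filter mem_iota => /and3P[].
by move=> /(congr1 (@nat_of_ord _)); rewrite !inordK // => ->.
Qed.

Lemma fifteen_gives_fusion (R : realType) (A : sita3 R) tau :
  partition tau labels -> tau \in fifteen -> gives_fusion A tau.
Proof.
move=> tauP; rewrite fifteenE => /mapP[P Pgen tauE]; apply/(gives_fusionP A tauP).
have fP := generic_fused (kA A) (lA A) (xA A) Pgen.
by move=> S T U a c; rewrite tauE => bS bT bU; apply: fP; apply: is_block_of_blocks.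
Qed.

(** * Eigenvalues in terms of the parameters *)

Section CharacterTable.
Variables (R : realType) (A : sita3 R) (k l r s : R).
Hypothesis charA : has_character_table A k l r s.

Lemma character_table_valency : k = kA A /\ l = lA A.
Proof.
have [chi [chi0 _ _ /matrixP tab]] := charA.
have := tab ord0 o1; have := tab ord0 o2; rewrite !mxE chi0 !rsc_valency /=.
by move=> /complexI <- /complexI <-.
Qed.

(** Applying a nonprincipal character to A_1^2 gives z^2 = (a - b - 1) z + a for its value z at A_1,
    where a = k x and b = l (1 - x). The two values r and s are distinct, so they are all the
    roots. *)
Lemma character_table_roots :
  r + s = kA A * xA A - lA A * (1 - xA A) - 1 /\ r * s = - (kA A * xA A).
Proof.
have [chi [chi0 chi_inj _ /matrixP tab]] := charA.
have quad i (z : R) : chi i (tnth (std A) o1) = real_complex R z ->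
    chi i (tnth (std A) o2) = real_complex R (-1 - z) ->
    z ^+ 2 = kA A + (kA A - 1 - lA A * (1 - xA A)) * z +
      (kA A - kA A * xA A) * (-1 - z).
  move=> e1 e2; apply: (@complexI R).
  transitivity (chi i (tnth (std A) o1 * tnth (std A) o1) : Cx R).
    by rewrite [RHS]rmorphM /= e1 rmorphXn.
  rewrite std_mulE sum3 !linearD !linearZ /= e1 e2 std0 rmorph1 !rscE !rsc_sconst /=.
  by rewrite !(rmorphD, rmorphN, rmorphM) /=; congr (_ + _ + _); exact: mulr1.
have er1 := tab o1 o1; have er2 := tab o1 o2.
have es1 := tab o2 o1; have es2 := tab o2 o2.
rewrite !mxE /= in er1 er2 es1 es2.
have qr := quad _ _ er1 er2; have qs := quad _ _ es1 es2.
(* Equal values would make the two characters agree on the basis. *)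
have rs : r - s != 0.
  rewrite subr_eq0; apply/eqP => rs.
  suff /chi_inj : chi o1 = chi o2 by [].
  apply/val_inj/lfunP => v; rewrite (stdE v) !linear_sum; apply: eq_bigr => j _.
  rewrite !linearZ; congr (_ *: _); elim/ord3P: j.
  - by rewrite std0 /= !rmorph1.
  - by rewrite /= er1 es1 rs.
  - by rewrite /= er2 es2 rs.
have sum : r + s = kA A * xA A - lA A * (1 - xA A) - 1.
  by apply: (mulIf rs); lra.
by split=> //; have -> : s = kA A * xA A - lA A * (1 - xA A) - 1 - r; lra.
Qed.

(** Sum and product determine the unordered pair of eigenvalues. A pair (p, q) found by solving the
    quadratic is thus (r, s) or (s, r), without deciding which. *)
Lemma special_exceptional p q :
  p + q = kA A * xA A - lA A * (1 - xA A) - 1 -> p * q = - (kA A * xA A) ->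
  exceptional k l p q -> exceptional k l r s \/ exceptional k l s r.
Proof.
have [sum prod] := character_table_roots; move=> sum' prod' exc.
have : (r - p) * (r - q) = 0.
  have -> : (r - p) * (r - q) = r ^+ 2 - r * (p + q) + p * q by ring.
  by rewrite sum' prod' -sum -prod; ring.
move/eqP; rewrite mulf_eq0 !subr_eq0 => /orP[]/eqP e.
  by have -> : s = q; [lra|left; rewrite e].
by have -> : s = p; [lra|right; rewrite e].
Qed.

End CharacterTable.

(** * Exclusion of the remaining partitions *)

Section Main.
Variables (R : realType) (A : sita3 R) (k l r s : R).

Lemma fusion_fifteen tau :
  has_character_table A k l r s -> nonexceptional k l r s ->
  partition tau labels -> gives_fusion A tau -> tau \in fifteen.
Proof.
move=> charA [nexc nexc'] tauP /(gives_fusionP A tauP) fus.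
have [ek el] := character_table_valency charA.
have exc p q : p + q = kA A * xA A - lA A * (1 - xA A) - 1 ->
    p * q = - (kA A * xA A) -> exceptional k l p q -> False.
  by move=> sum prod e; have [] := special_exceptional charA sum prod e.
rewrite ek el in exc.
have x01 : 0 < xA A < 1.
  have /andP[x0 x1] := xA_bounds A; rewrite !lt_neqAle x0 x1 !andbT.
  apply/andP; split; apply/eqP => ex.
    (* For x = 0 the eigenvalues are 0 and -1 - l, which is condition (b). *)
    apply: (exc 0 (-1 - lA A)); rewrite -?ex; [ring|ring|].
    by right; left; split; ring.
  (* For x = 1 they are k and -1, which is condition (a). *)
  apply: (exc (kA A) (-1)); rewrite ?ex; [ring|ring|].
  by left.
have [P [Psurv Pblk Pcov]] := survivors_complete x01 (lam_ge0 A) (mu_ge0 A) fus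
  (@is_block_subseqs tau) (is_block_cover tauP) (is_block_disj tauP).
have {Psurv} /hasP[Q + PQ] := allP survivorsE P Psurv.
rewrite (of_blocks_partition tauP Pblk Pcov) (of_blocks_perm PQ) fifteenE.
rewrite mem_cat => /orP[Qgen|Qspec]; first exact: map_f.
exfalso; have fQ : fused (kA A) (lA A) (xA A) (fun B => B \in Q).
  move=> S T U a c; rewrite -!(perm_mem PQ) => /Pblk bS /Pblk bT /Pblk bU.
  exact: fus.
have [] := special_blocks_case (kA_gt0 A) (lA_gt0 A) x01 (lam_ge0 A)
  (mu_ge0 A) Qspec fQ.
(* Case C uses r and s directly. In the other cases the pair given to [exc] consists of the roots of
   z^2 = (a - b - 1) z + a for the values of a and b found there. *)
- move=> kl x2; have [sum prod] := character_table_roots charA.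
  apply: (exc r s) => //; right; right; left; split=> //.
  by rewrite kl x2 in sum; lra.
- move=> m ek' el' ea eb; apply: (exc 1 (- m)); rewrite ?ea ?eb; [ring|ring|].
  by do 3 right; left; rewrite ek' el'; split; ring.
- move=> m ek' el' ea eb; apply: (exc (m - 1) (-2)); rewrite ?ea ?eb; [ring|ring|].
  by do 4 right; left; rewrite ek' el'; split; ring.
- move=> ek' ea eb; apply: (exc (lA A - 3) (-2)); rewrite ?ea ?eb; [ring|ring|].
  by do 6 right; left; rewrite ek'; split; ring.
- move=> el' ea eb; apply: (exc 1 (2 - kA A)); rewrite ?ea ?eb; [ring|ring|].
  by do 7 right; left; rewrite el'; split; ring.
- move=> q ek' el' ea eb; apply: (exc q (- q)); rewrite ?ea ?eb; [ring|ring|].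
  by do 8 right; left; rewrite ek' el'.
- move=> q ek' el' ea eb; apply: (exc (-2 - q) q); rewrite ?ea ?eb; [ring|ring|].
  by do 9 right; rewrite ek' el'.
Qed.

End Main.

(** * The algebra of the Petersen graph *)

(** The algebra is realized as C^3 with componentwise product: each A_j becomes the column of its
    character values, and the characters are the coordinate projections. *)
Definition triple (R : realType) : Type := 'rV[Cx R]_3.

Section Petersen.
Variable R : realType.
Local Notation C := (Cx R).
Local Notation triple := (triple R).

HB.instance Definition _ := Vector.copy triple 'rV[C]_3.

Definition triple_mul (X Y : triple) : triple := \row_i (X ord0 i * Y ord0 i).
Definition triple_one : triple := const_mx 1.

Lemma tripleP (X Y : triple) : (forall i, X ord0 i = Y ord0 i) -> X = Y.
Proof. by move=> e; apply/rowP. Qed.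

Lemma triple_mulA : associative triple_mul.
Proof. by move=> X Y Z; apply: tripleP => i; rewrite !mxE mulrA. Qed.
Lemma triple_mul1 : left_id triple_one triple_mul.
Proof. by move=> X; apply: tripleP => i; rewrite !mxE mul1r. Qed.
Lemma triple_mulC : commutative triple_mul.
Proof. by move=> X Y; apply: tripleP => i; rewrite !mxE mulrC. Qed.
Lemma triple_mulDl : left_distributive triple_mul +%R.
Proof. by move=> X Y Z; apply: tripleP => i; rewrite !mxE mulrDl. Qed.
Lemma triple_one_neq0 : triple_one != 0.
Proof. by apply/eqP => /rowP/(_ ord0)/eqP; rewrite !mxE oner_eq0. Qed.

HB.instance Definition _ := GRing.Zmodule_isComNzRing.Build triple
  triple_mulA triple_mulC triple_mul1 triple_mulDl triple_one_neq0.

Lemma triple_scaleAl (a : C) (X Y : triple) : a *: (X * Y) = (a *: X) * Y.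
Proof. by apply: tripleP => i; rewrite !mxE mulrA. Qed.
HB.instance Definition _ := GRing.Lmodule_isLalgebra.Build C triple triple_scaleAl.

Lemma triple_scaleAr (a : C) (X Y : triple) : a *: (X * Y) = X * (a *: Y).
Proof. by rewrite ![X * _]mulrC triple_scaleAl. Qed.
HB.instance Definition _ := GRing.Lalgebra_isAlgebra.Build C triple triple_scaleAr.
HB.instance Definition _ := Algebra_isFalgebra.Build C triple.

Definition petersen_entry (i j : nat) : C :=
  (nth [::] [:: [:: 1; 3; 6]; [:: 1; 1; -2]; [:: 1; -2; 1]] i)`_j.

Definition petersen_std : 3.-tuple triple :=
  [tuple (\row_i petersen_entry i j : triple) | j < 3].

Lemma petersen_stdE j i : tnth petersen_std j ord0 i = petersen_entry i j.
Proof. by rewrite tnth_mktuple mxE. Qed.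

Lemma triple_sumE (I : finType) (F : I -> triple) i :
  (\sum_j F j) ord0 i = \sum_j F j ord0 i.
Proof. exact: summxE. Qed.

Lemma petersen_basis : basis_of {:triple} petersen_std.
Proof.
rewrite basisEfree; apply/and3P; split; [|exact: subvf|by rewrite dimvf size_tuple].
apply/(@freeP _ _ 3 petersen_std) => a; under eq_bigr do rewrite -tnth_nth.
move=> /rowP e.
have eq (i : 'I_3) :
    a o0 * petersen_entry i 0 + a o1 * petersen_entry i 1 +
    a o2 * petersen_entry i 2 = 0.
  have := e i; rewrite mxE summxE sum3 => <-.
  by rewrite !mxE !petersen_stdE.
have e0 := eq o0; have e1 := eq o1; have e2 := eq o2.
rewrite /petersen_entry /= in e0 e1 e2.
have h2 : a o2 = 0.
  (* The weights 3, -5, 2 on the three equations cancel the first two unknowns. *)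
  have : 30 * a o2 = 0.
    rewrite -[RHS](_ : 3 * 0 - 5 * 0 + 2 * 0 = 0); last by ring.
    by rewrite -{1}e0 -{1}e1 -e2; ring.
  by move/eqP; rewrite mulf_eq0 pnatr_eq0 /= => /eqP.
have h1 : a o1 = 0.
  have : 3 * a o1 = 0.
    rewrite -[RHS](subrr (0 : C)) -{1}e1 -{1}e2 h2; ring.
  by move/eqP; rewrite mulf_eq0 pnatr_eq0 /= => /eqP.
elim/ord3P => //.
by rewrite h1 h2 !mul0r !addr0 mulr1 in e1.
Qed.

Definition petersen_sconst (i j h : nat) : nat :=
  nth 0 (nth [::] (nth [::]
    [:: [:: [:: 1; 0; 0]; [:: 0; 1; 0]; [:: 0; 0; 1]];
        [:: [:: 0; 1; 0]; [:: 3; 0; 1]; [:: 0; 2; 2]];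
        [:: [:: 0; 0; 1]; [:: 0; 2; 2]; [:: 6; 4; 3]]] i) j) h.

Lemma petersen_mul i j :
  tnth petersen_std i * tnth petersen_std j =
  \sum_(h < 3) (petersen_sconst i j h)%:R *: tnth petersen_std h.
Proof.
apply: tripleP => m; rewrite mxE triple_sumE sum3 !mxE !petersen_stdE.
elim/ord3P: i; elim/ord3P: j; elim/ord3P: m;
  by rewrite /petersen_entry /petersen_sconst /=; ring.
Qed.

Lemma petersen_structure i j h : structure_constant petersen_std i j h =
  (petersen_sconst i j h)%:R.
Proof.
rewrite /structure_constant petersen_mul; under eq_bigr do rewrite (tnth_nth 0).
by rewrite coord_sum_free // (basis_free petersen_basis).
Qed.

Definition triple_proj (i : 'I_3) (X : triple) : C^o := X ord0 i.

Lemma triple_proj_linear i : linear (triple_proj i).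
Proof. by move=> a X Y; rewrite /triple_proj !mxE. Qed.
HB.instance Definition _ i := GRing.isLinear.Build C triple C^o _ (triple_proj i)
  (triple_proj_linear i).

Lemma triple_proj_ahom i : ahom_in {:triple} (linfun (triple_proj i)).
Proof.
by apply/ahom_inP; split=> [X Y _ _|]; rewrite !lfunE /= /triple_proj mxE.
Qed.

Definition petersen_chi i : 'AHom(triple, C^o) := AHom (triple_proj_ahom i).

Lemma petersen_chiE i X : petersen_chi i X = X ord0 i.
Proof. by rewrite lfunE. Qed.

Lemma petersen_chi_std i j :
  petersen_chi i (tnth petersen_std j) = petersen_entry i j.
Proof. by rewrite petersen_chiE petersen_stdE. Qed.

Definition petersen : sita3 R.
Proof.
apply: (@Sita3 R triple petersen_std (petersen_chi ord0)).
- exact: petersen_basis.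
- by apply: tripleP => i; rewrite petersen_stdE mxE; elim/ord3P: i.
- exact: mulrC.
- by move=> i j h; rewrite petersen_structure ler0n.
- by move=> i j; rewrite petersen_structure; elim/ord3P: i; elim/ord3P: j.
- by move=> i; rewrite petersen_structure petersen_chi_std; elim/ord3P: i.
- elim/ord3P; rewrite petersen_chi_std.
  + by exists 1%N.
  + by exists 3%N.
  + by exists 6%N.
Defined.

Lemma petersen_entryE (i j : 'I_3) :
  petersen_entry i j = real_complex R (table3 3 6 1 (-2) i j).
Proof.
rewrite mxE; elim/ord3P: i; elim/ord3P: j;
  rewrite /petersen_entry /= ?(rmorphB, rmorphN, rmorph1, rmorph_nat) //; ring.
Qed.

(** The unit vectors are orthogonal idempotents with sum 1, so a homomorphism sends exactly one of
    them to 1 and the others to 0. *)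
Lemma triple_ahomP (phi : 'AHom(triple, C^o)) : exists i, phi = petersen_chi i.
Proof.
pose d i : triple := delta_mx ord0 i.
have sumd (X : triple) : X = \sum_i X ord0 i *: d i by exact: row_sum_delta.
have dM i j : d i * d j = (i == j)%:R *: d i.
  apply: tripleP => m; rewrite !mxE /=.
  by case: (eqVneq m i) => [->|_]; rewrite ?mul1r ?mulr1 // mul0r mulr0.
have phiM i j : phi (d i) * phi (d j) = (i == j)%:R * phi (d i) :> C.
  transitivity (phi (d i * d j) : C); first by rewrite rmorphM.
  by rewrite dM linearZ.
have [i phi_i] : exists i, phi (d i) != 0.
  apply/existsP; apply: contraT => /existsPn phi0.
  have : phi 1 = 1 :> C by rewrite rmorph1.
  rewrite (sumd 1) linear_sum big1 => [/eqP|i _].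
    by rewrite eq_sym oner_eq0.
  by rewrite linearZ /= (eqP (negbNE (phi0 i))) scaler0.
have phi_i1 : phi (d i) = 1 by apply: (mulIf phi_i); rewrite phiM eqxx.
exists i; apply/val_inj/lfunP => X /=.
rewrite petersen_chiE {1}(sumd X) linear_sum (bigD1 i) //= big1 => [|j ji].
  by rewrite linearZ /= phi_i1 addr0; exact: mulr1.
have : phi (d j) * phi (d i) = 0 :> C by rewrite phiM (negPf ji) mul0r.
by rewrite phi_i1 mulr1 linearZ /= => ->; rewrite scaler0.
Qed.

Lemma petersen_character_table : has_character_table petersen 3 6 1 (-2).
Proof.
exists petersen_chi; split=> //; last first.
- by apply/matrixP => i j; rewrite !mxE petersen_chi_std petersen_entryE mxE.
- exact: triple_ahomP.
- move=> i j /(congr1 (fun f : 'AHom(triple, C^o) => f (tnth petersen_std o1))).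
  rewrite !petersen_chi_std !petersen_entryE => /complexI; rewrite !mxE.
  by elim/ord3P: i; elim/ord3P: j => //= ?; exfalso; lra.
Qed.

Lemma petersen_generic : generic_sita3 petersen.
Proof.
exists 3, 6, 1, (-2); split; [exact: petersen_character_table|lra|].
by split; rewrite /exceptional => e; decompose [and or and3] e; lra.
Qed.

End Petersen.

Theorem theorem5p1 (R : realType) :
  (forall (A : sita3 R) (k l r s : R),
     has_character_table A k l r s -> s <= r -> nonexceptional k l r s ->
     forall tau : {set {set 'I_10}}, partition tau labels ->
       (gives_fusion A tau <-> tau \in fifteen)) /\
  (forall tau : {set {set 'I_10}}, partition tau labels ->
     ((forall A : sita3 R, generic_sita3 A -> gives_fusion A tau) <->
      tau \in fifteen) /\
     ((forall A : sita3 R, gives_fusion A tau) <-> tau \in fifteen)).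
Proof.
split=> [A k l r s charA _ nexc tau tauP|tau tauP].
  by split; [apply: fusion_fifteen charA nexc tauP|apply: fifteen_gives_fusion].
have fif A : tau \in fifteen -> gives_fusion A tau :=
  @fifteen_gives_fusion R A tau tauP.
(* One nonexceptional algebra suffices for both equivalences: a partition that is always a fusion is
   one for the Petersen graph. *)
have petersenP : gives_fusion (petersen R) tau -> tau \in fifteen.
  have [k [l [r [s [charA _ nexc]]]]] := petersen_generic R.
  exact: fusion_fifteen charA nexc tauP.
split; split=> [h|tau15 A *]; do ?[exact: fif].
  by apply: petersenP; apply: h; apply: petersen_generic.
by apply: petersenP; apply: h.
Qed.
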